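(* For every $\gamma\in(0,1)$ there exists $\epsilon=\epsilon(\gamma)>0$ such that the following holds. Let $p$ be a sufficiently large prime, let $P=A\times B\subseteq(\mathbb{F}_p^2\times\mathbb{F}_p^2)\setminus\{(0,0,0,0)\}$, and let $S$ be a symmetric subset of $SL_2(\mathbb{F}_p)$ with $p^\gamma<|S|<p^{3-2\gamma}$ and $|S\cap gH|<p^{-\gamma/2}|S|$ for every proper subgroup $H\subsetneq SL_2(\mathbb{F}_p)$ and every $g\in SL_2(\mathbb{F}_p)$. Assume every line through the origin contains at most $k$ points of $B$. Then (1) if $|B|<k^{1/2}p$, \[I(P,S)\lesssim k^{1/2}|A|^{1/2}|S|+k^{1/4}p^{\frac{1-\epsilon}{4}}|A|^{1/2}|B|^{1/2}|S|^{3/4};\] (2) if $|B|\ge k^{1/2}p$, \[I(P,S)\lesssim\frac{|A|^{1/2}|B||S|^{3/4}}{p^{\frac{1+\epsilon}{4}}}.\]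
   Context: $S$ symmetric means $S=S^{-1}$. $I(P,S)$ is the number of pairs $((x,y),\theta)\in P\times S$ with $\theta y=x$ (matrices acting on column vectors). A line through the origin is a one-dimensional subspace of $\mathbb{F}_p^2$. $X\lesssim Y$ means $X\le C\log_2 p\cdot Y$ for a constant $C$ independent of $p,A,B,S,k$. *)

(* Defs.v *)
From HB Require Import structures.
From mathcomp Require Import all_boot all_order all_fingroup all_algebra.
From mathcomp Require Import all_classical all_reals all_analysis.

Set Implicit Arguments.
Unset Strict Implicit.
Unset Printing Implicit Defensive.

Import Order.TTheory GRing.Theory Num.Theory.
Local Open Scope ring_scope.

(* A set rather than a type, so that subgroups of SL_2(F_p) are groups of type
   {group {'GL_2['F_p]}} contained in it. *)
Definition SL2 (p : nat) : {set {'GL_2['F_p]}} :=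
  [set g : {'GL_2['F_p]} | \det (GLval g) == 1]%SET.

Lemma SL2_group_set (p : nat) : group_set (SL2 p).
Proof.
apply/group_setP; split=> [|g h]; first by rewrite inE GL_1E det1.
by rewrite !inE GL_ME det_mulmx => /eqP-> /eqP->; rewrite mulr1.
Qed.

Canonical SL2_group (p : nat) : {group {'GL_2['F_p]}} := Group (SL2_group_set p).

Definition incidences (p : nat) (P : {set 'cV['F_p]_2 * 'cV['F_p]_2})
    (S : {set {'GL_2['F_p]}}) : nat :=
  #|[set t in finset.setX P S | GLval t.2 *m t.1.2 == t.1.1]%SET|.

Definition at_most_on_lines (p : nat) (B : {set 'cV['F_p]_2}) (k : nat) : Prop :=
  forall L : {vspace 'cV['F_p]_2}, \dim L = 1%N ->
    (#|[set y in B | y \in L]%SET| <= k)%N.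

Definition log2 (R : realType) (x : R) : R := ln x / ln 2.

(* Main.v *)
(* By Cauchy-Schwarz, I(P, S)^2 <= |A| sum_g r(g) N(g), where r(g) counts the representations
   of g as a quotient of two elements of S and N(g) = |{y in B : g y in B}|; a second
   Cauchy-Schwarz bounds I(P, S)^4 by |A|^2 times the multiplicative energy of S times
   sum_g N(g)^2.  The last sum is at most |B|^4 / p + 2 k p |B|^2: a pair (y, z) of independent
   vectors and its image determine g and have the same determinant, so one needs the variance
   of the number of pairs in B x B with determinant d, which is controlled by Cauchy-Schwarz
   over the lines through the origin.

   It remains to save a power of p in the energy.  If the energy is at least |S|^3 / K, then by
   Balog-Szemeredi-Gowers and an argument of Tao, a large part of S lies in a coset of an
   approximate subgroup D of comparable size.  Non-concentration of S forces D to generate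
   SL_2(F_p), and then D is either tiny or almost everything, by the pivot argument of Helfgott
   and Pyber-Szabo: if a torus T contains a regular element of D^2, then counting conjugates
   in a fixed trace class (which has at most K^O(1) |D|^(2/3) elements in D^4) gives
   |D^2 cap T| >= |D|^(1/3) / K^O(1), this property passes from T to all its conjugates, and
   summing over the p^2 conjugates of T gives |D| >= p^3 / K^O(1). *)
Require Import Defs.
From HB Require Import structures.
From mathcomp Require Import all_boot all_order all_fingroup all_algebra.
From mathcomp Require Import zify ring lra.

Set Implicit Arguments.
Unset Strict Implicit.
Unset Printing Implicit Defensive.

Import Order.TTheory GRing.Theory Num.Theory.
Local Open Scope nat_scope.

(** * Noncommutative Balog-Szemeredi-Gowers *)

(** The exponent 2/3 for a trace class X comes from sending a triple (x, y, z) of X to the pair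
    (x^-1 y, x^-1 z). When the two quotients do not commute, a fibre is cut out by det x = 1 and
    three independent trace conditions, hence by a quadric and a line in the space of matrices; it
    has at most two points unless the direction of the line is singular. In the exceptional cases
    two of x, y, z differ by a singular matrix, so their quotient fixes a vector. The obstacle is
    thus the part of a power of D inside the fixer of a vector. It has at most about |D|^(1/2)
    elements, because D contains an element moving the line of that vector; this uses D^17 = D^8 D
    D^8, the highest power in play. Trace 0 is avoided together with 2 and -2, because there x and
    -x have the same trace. All losses are powers of one integer K >= 2, which also absorb the
    numerical constants, and K is taken so small a power of p that K^N <= p^(gamma/2); this
    contradicts each of the three structural outcomes for S. *)

Lemma sum_leq_CauchySchwarz (I : finType) (P : pred I) (f g : I -> nat) :
  (\sum_(i | P i) f i * g i) ^ 2
    <= (\sum_(i | P i) f i ^ 2) * (\sum_(i | P i) g i ^ 2).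
Proof.
rewrite -mulnn !big_distrlr /=.
set a := \sum_(i | P i) _; set b := \sum_(i | P i) _.
(* Symmetrised over pairs (i, j), the claim is 2 u v <= u^2 + v^2 with u = [f i * g j] and v =
   [f j * g i]. *)
suff: 2 * a <= b + b by lia.
rewrite {2}/b exchange_big /= -big_split big_distrr; apply: leq_sum => i _ /=.
rewrite -big_split big_distrr; apply: leq_sum => j _ /=.
have := (nat_Cauchy (f i * g j) (f j * g i)).1; rewrite !expnMn; nia.
Qed.

Lemma sum_sqr_leq_card (I : finType) (A : {set I}) (f : I -> nat) :
  (\sum_(i in A) f i) ^ 2 <= #|A| * \sum_(i in A) f i ^ 2.
Proof.
have := sum_leq_CauchySchwarz (mem A) (fun=> 1) f.
by rewrite sum_nat_const muln1; under eq_bigr do rewrite mul1n.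
Qed.

Lemma card_set_sum (T : finType) (A : {set T}) (P : pred T) :
  #|[set x in A | P x]| = \sum_(x in A) P x.
Proof.
by rewrite -sum1dep_card big_mkcondr; apply: eq_bigr => x _; case: (P x).
Qed.

Lemma card_leq_fibers (T U : finType) (f : T -> U) (A : {set T}) (B : {set U}) c :
  {in A, forall x, f x \in B} ->
  {in B, forall y, #|[set x in A | f x == y]| <= c} -> #|A| <= c * #|B|.
Proof.
move=> fAB fib; rewrite -sum1_card (partition_big f (mem B)) //=.
rewrite mulnC -sum_nat_const; apply: leq_sum => y yB.
by apply: leq_trans (fib y yB); rewrite sum1dep_card.
Qed.

Lemma card_leq_inj (T U : finType) (f : T -> U) (A : {set T}) (B : {set U}) :
  {in A &, injective f} -> {in A, forall x, f x \in B} -> #|A| <= #|B|.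
Proof.
move=> finj fAB; rewrite -(card_in_imset finj); apply: subset_leq_card.
by apply/subsetP => _ /imsetP[x xA ->]; apply: fAB.
Qed.

(** The representation function r(h) of the overview: [b] stands for the pair (h b, b), whose
    quotient is h. *)
Definition quot_count (gT : finGroupType) (S : {set gT}) (h : gT) : nat :=
  #|[set b in S | (h * b)%g \in S]|.

Definition mul_energy (gT : finGroupType) (S : {set gT}) : nat :=
  \sum_h quot_count S h ^ 2.

Lemma sum_quot_count_in (gT : finGroupType) (S H : {set gT}) :
  \sum_(h in H) quot_count S h
    = \sum_(z in S) #|[set x in S | (x * z^-1)%g \in H]|.
Proof.
under eq_bigr do rewrite /quot_count card_set_sum.
rewrite exchange_big; apply: eq_bigr => z zS /=.
rewrite card_set_sum (reindex_inj (mulIg z^-1%g)) /= big_mkcond [RHS]big_mkcond.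
by apply: eq_bigr => x _; rewrite mulgKV; case: (_ \in H); case: (_ \in S).
Qed.

Lemma sum_quot_count (gT : finGroupType) (S : {set gT}) :
  \sum_h quot_count S h = #|S| ^ 2.
Proof.
rewrite (eq_bigl (mem [set: gT])) => [|h]; last by rewrite /= inE.
rewrite sum_quot_count_in (eq_bigr (fun=> #|S|)) ?sum_nat_const ?mulnn // => z _.
by apply: eq_card => x; rewrite !inE andbT.
Qed.

(** Quotients outside [H] have fewer than |S|/(2K) representations and so carry at most half of the
    energy |S|^3/K. On [H] one factor of the square is bounded by |S|. The size of [H] is Markov's
    inequality. *)
Lemma popular_quotients (gT : finGroupType) (S : {set gT}) (K : nat) :
  0 < #|S| -> #|S| ^ 3 <= K * mul_energy S ->
  let H := [set h | #|S| <= 2 * K * quot_count S h] in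
  #|S| ^ 2 <= 2 * K * \sum_(h in H) quot_count S h /\ #|H| <= 2 * K * #|S|.
Proof.
move=> S0 hE H; set q := quot_count S; set n := #|S| in S0 hE *.
have sq : \sum_h q h = n ^ 2 by apply: sum_quot_count.
split; last first.
  have: #|H| * n <= 2 * K * n ^ 2.
    rewrite -sq big_distrr /= -sum_nat_const.
    apply: (@leq_trans (\sum_(h in H) 2 * K * q h)).
      by apply: leq_sum => h; rewrite inE.
    by rewrite [leqRHS](bigID (mem H)) leq_addr.
  by rewrite -mulnn mulnA leq_pmul2r.
have lo : 2 * K * \sum_(h | h \notin H) q h ^ 2 <= n ^ 3.
  rewrite expnS mulnC -sq big_distrl big_distrr /=.
  rewrite [leqRHS](bigID (mem H)) /= -[leqLHS]add0n leq_add //.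
  apply: leq_sum => h; rewrite inE -ltnNge => hlt.
  by rewrite -mulnn -mulnA mulnC leq_mul2r mulnC (ltnW hlt) orbT.
have hi : 2 * K * \sum_(h in H) q h ^ 2 <= n * (2 * K * \sum_(h in H) q h).
  rewrite mulnCA leq_mul2l; apply/orP; right.
  rewrite big_distrr; apply: leq_sum => h _ /=; rewrite -mulnn leq_mul2r.
  apply/orP; right; apply/subset_leq_card/subsetP => x; by rewrite inE => /andP[].
have {}hE : n ^ 3 <= K * (\sum_(h in H) q h ^ 2 + \sum_(h | h \notin H) q h ^ 2).
  by move: hE; rewrite /mul_energy (bigID (mem H)).
suff: n * n ^ 2 <= n * (2 * K * \sum_(h in H) q h) by rewrite leq_pmul2l.
apply: leq_trans hi; move: hE lo; rewrite -expnS.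
move: (\sum_(h in H) q h ^ 2) (\sum_(h | h \notin H) q h ^ 2) (n ^ 3) => u v w.
by clear; nia.
Qed.

Definition common_nbrs (T : finType) (S : {set T}) (e : rel T) (x y : T) : nat :=
  #|[set z in S | e x z && e y z]|.

Lemma common_nbrsC (T : finType) (S : {set T}) (e : rel T) (x y : T) :
  common_nbrs S e x y = common_nbrs S e y x.
Proof. by apply: eq_card => z; rewrite !inE [e x z && _]andbC. Qed.

(* The subset is a neighbourhood N(z) for a vertex z found by averaging
   8 K^2 |N(z)|^2 - 128 K^2 #{pairs of N(z) with few common neighbours}. *)
Lemma dense_graph_nbhd (T : finType) (S : {set T}) (e : rel T) (K : nat) :
  0 < #|S| ->
  #|S| ^ 2 <= 2 * K * \sum_(z in S) #|[set x in S | e x z]| ->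
  exists2 N : {set T}, N \subset S & #|S| <= 3 * K * #|N| /\
    16 * #|[set t in setX N N | 128 * K ^ 2 * common_nbrs S e t.1 t.2 < #|S|]|
      <= #|N| ^ 2.
Proof.
set n := #|S| => n0 he; pose N z := [set x in S | e x z].
pose bad (t : T * T) := 128 * K ^ 2 * common_nbrs S e t.1 t.2 < n.
pose b z := #|[set t in setX (N z) (N z) | bad t]|.
have sN : n ^ 3 <= 4 * K ^ 2 * \sum_(z in S) #|N z| ^ 2.
  suff: n * n ^ 3 <= n * (4 * K ^ 2 * \sum_(z in S) #|N z| ^ 2) by rewrite leq_pmul2l.
  have cs := sum_sqr_leq_card S (fun z => #|N z|).
  apply: (@leq_trans ((2 * K) ^ 2 * (\sum_(z in S) #|N z|) ^ 2)).
    by rewrite -expnMn (_ : n * n ^ 3 = (n ^ 2) ^ 2) ?leq_exp2r // -expnM -expnS.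
  rewrite expnMn mulnCA leq_mul2l; apply/orP; right; exact: cs.
(* A bad pair lies in N(z) exactly when z is a common neighbour, so it is counted fewer than n /
   (128 K^2) times. *)
have sb : 128 * K ^ 2 * \sum_(z in S) b z <= n ^ 3.
  have -> : \sum_(z in S) b z
      = \sum_(t in setX S S | bad t) common_nbrs S e t.1 t.2.
    rewrite /b; under eq_bigr do rewrite -sum1_card big_mkcond /=.
    rewrite exchange_big /= [RHS]big_mkcond; apply: eq_bigr => -[x y] _ /=.
    rewrite !inE /=; case: ifP => [/andP[/andP[xS yS] bxy]|xyS].
      rewrite /common_nbrs card_set_sum; apply: eq_bigr => z _.
      by rewrite !inE /= xS yS bxy !andbT; case: ifP.
    apply: big1 => z _; case: ifP => //; rewrite !inE /=.
    by case/andP => /andP[/andP[xS _] /andP[yS _]] bxy; rewrite xS yS bxy in xyS.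
  apply: (@leq_trans (\sum_(t in setX S S) n)).
    rewrite big_distrr big_mkcondr /=; apply: leq_sum => t _.
    by case: ifP => // /ltnW.
  by rewrite sum_nat_const cardsX -/n mulnn -expnSr.
have [z zS hz] : exists2 z, z \in S &
    n ^ 2 + 128 * K ^ 2 * b z <= 8 * K ^ 2 * #|N z| ^ 2.
  apply/exists_inP; rewrite -[X in is_true X]negbK negb_exists_in.
  apply/negP => /forall_inP lt.
  have: \sum_(z in S) (8 * K ^ 2 * #|N z| ^ 2) <
        \sum_(z in S) (n ^ 2 + 128 * K ^ 2 * b z).
    have [z0 z0S] : exists z, z \in S by apply/set0Pn; rewrite -card_gt0.
    rewrite (bigD1 z0) //= [ltnRHS](bigD1 z0) //= -addSn leq_add //.
      by rewrite ltnNge lt.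
    by apply: leq_sum => z /andP[zS _]; rewrite ltnW // ltnNge lt.
  rewrite -big_distrr big_split -big_distrr /= sum_nat_const -/n (_ : n * n ^ 2 = n ^ 3) //.
  rewrite -big_distrr /=.
  apply/negP; rewrite -leqNgt (leq_trans (leq_add (leqnn _) sb)) //.
  by apply: leq_trans (leq_add sN sN) (eq_leq _); rewrite -!mulnDl.
have K0 : 0 < K by case: (K) hz n0 => //; lia.
exists (N z); first by apply/subsetP => x; rewrite inE => /andP[].
split.
  rewrite -leq_sqr !expnMn -/n; apply: leq_trans (leq_addr _ _) (leq_trans hz _).
  by rewrite !leq_mul2r; apply/orP; right; apply/orP; right.
have : 8 * K ^ 2 * (16 * b z) <= 8 * K ^ 2 * #|N z| ^ 2 by lia.
by rewrite leq_pmul2l // muln_gt0 expn_gt0 K0.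
Qed.

(** Since at most 1/16 of the pairs in N are bad, at most a quarter of the vertices have more than
    |N|/4 bad partners. [X] is the rest: two of its vertices together lose at most half of N. *)
Lemma dense_graph_core (T : finType) (S : {set T}) (e : rel T) (K : nat) :
  0 < #|S| ->
  #|S| ^ 2 <= 2 * K * \sum_(z in S) #|[set x in S | e x z]| ->
  let good x y := #|S| <= 128 * K ^ 2 * common_nbrs S e x y in
  exists2 N : {set T}, N \subset S & exists2 X : {set T}, X \subset N &
    [/\ #|S| <= 3 * K * #|N|, 3 * #|N| <= 4 * #|X| &
        {in X &, forall x y, #|N| <= 2 * #|[set w in N | good x w && good w y]|}].
Proof.
move=> n0 he good; have [N NS [hN hb]] := dense_graph_nbhd n0 he.
exists N => //; pose nb x := #|[set w in N | ~~ good x w]|.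
pose X := [set x in N | 4 * nb x <= #|N|].
exists X; first by apply/subsetP => x; rewrite inE => /andP[].
have N0 : 0 < #|N| by case: #|N| hN n0 => //; lia.
have goodC x y : good x y = good y x by rewrite /good common_nbrsC.
split=> //.
  have hsum : #|[set t in setX N N | 128 * K ^ 2 * common_nbrs S e t.1 t.2 < #|S|]|
      = \sum_(x in N) nb x.
    rewrite card_set_sum; rewrite (eq_bigl (fun t => (t.1 \in N) && (t.2 \in N))).
      rewrite -(pair_big (mem N) (mem N)
        (fun x y => nat_of_bool (128 * K ^ 2 * common_nbrs S e x y < #|S|))) /=.
      apply: eq_bigr => x _; rewrite /nb card_set_sum; apply: eq_bigr => y _.
      by rewrite /good ltnNge.
    by move=> [x y]; rewrite inE.
  rewrite hsum in hb.
  have: #|N :\: X| * #|N| <= 4 * \sum_(x in N) nb x.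
    rewrite big_distrr /= -sum_nat_const.
    rewrite [leqRHS](bigID (mem X)) /= -[leqLHS]add0n leq_add //.
    rewrite [leqLHS](eq_bigl (fun x => (x \in N) && (x \notin X))); last first.
      by move=> x; rewrite in_setD andbC.
    apply: leq_sum => x /andP[xN]; rewrite inE xN -ltnNge => /ltnW //.
  have XN : X \subset N by apply/subsetP => x; rewrite inE => /andP[].
  rewrite cardsD (setIidPr XN) => h.
  have XleN := subset_leq_card XN.
  have: 4 * (#|N| - #|X|) <= #|N| by rewrite -(leq_pmul2r N0); lia.
  lia.
move=> x y; rewrite !inE => /andP[xN hx] /andP[yN hy].
have: #|N| <= #|[set w in N | good x w && good w y]| + (nb x + nb y).
  rewrite -sum1_card card_set_sum /nb !card_set_sum -!big_split /=.
  by apply: leq_sum => w _; rewrite [good y w]goodC; case: (good x w); case: (good w y).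
lia.
Qed.

(* Each element of X X^-1 is x w^-1 (y w^-1)^-1 for many w, and both factors are in many
   ways quotients of popular quotients. *)
Lemma balog_szemeredi_gowers (gT : finGroupType) (S : {set gT}) (K : nat) :
  0 < #|S| -> #|S| ^ 3 <= K * mul_energy S ->
  exists2 X : {set gT}, X \subset S &
    #|S| <= 4 * K * #|X| /\ #|(X * X^-1)%g| <= 2 ^ 23 * K ^ 10 * #|X|.
Proof.
move=> n0 hE; have [hH cH] := popular_quotients n0 hE.
set H := [set h | _] in hH cH; set n := #|S| in n0 hE hH cH *.
rewrite sum_quot_count_in in hH.
pose e (x z : gT) := (x * z^-1)%g \in H.
have [N NS [X XN [hN hX hgood]]] := dense_graph_core (e := e) n0 hH.
exists X; first exact: subset_trans XN NS.
rewrite -/n in hN hgood; set L := 128 * K ^ 2 in hgood.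
have LE : L = 128 * K ^ 2 by []; clearbody L.
have hX2 : n <= 4 * K * #|X|.
  have : 3 * n <= 3 * K * (4 * #|X|).
    apply: (@leq_trans (3 * K * (3 * #|N|))); first lia.
    by rewrite leq_mul2l hX orbT.
  by lia.
split=> //.
pose m (t : gT * gT * (gT * gT)) := (t.1.1 * t.1.2^-1 * (t.2.1 * t.2.2^-1))%g.
pose H4 := setX (setX H H) (setX H H).
have rep q : q \in (X * X^-1)%g ->
    #|N| * n ^ 2 <= 2 * L ^ 2 * #|[set t in H4 | m t == q]|.
  case/mulsgP => x y' xX; rewrite inE => yX ->; set y := y'^-1%g in yX.
  have -> : y' = y^-1%g by rewrite invgK.
  pose good a b := n <= L * common_nbrs S e a b.
  set W := [set w in N | good x w && good w y].
  have hW : #|N| <= 2 * #|W| by apply: hgood.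
  pose P := [set u : gT * (gT * gT) | [&& u.1 \in W, u.2.1 \in S, u.2.2 \in S,
     e x u.2.1 && e u.1 u.2.1 & e u.1 u.2.2 && e y u.2.2]].
  have hP : #|W| * n ^ 2 <= L ^ 2 * #|P|.
    have -> : #|P| = \sum_(w in W) common_nbrs S e x w * common_nbrs S e w y.
      rewrite -sum1_card.
      rewrite (eq_bigl (fun u : gT * (gT * gT) => (u.1 \in W) &&
        [&& u.2.1 \in S, u.2.2 \in S,
         e x u.2.1 && e u.1 u.2.1 & e u.1 u.2.2 && e y u.2.2])); last first.
        by move=> u; rewrite inE.
      rewrite -(pair_big_dep (mem W) (fun w (v : gT * gT) => [&& v.1 \in S,
        v.2 \in S, e x v.1 && e w v.1 & e w v.2 && e y v.2]) (fun _ _ => 1)) /=.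
      apply: eq_bigr => w wW; rewrite sum1dep_card /common_nbrs -cardsX.
      apply: eq_card => -[a b]; rewrite !inE /=.
      by case: (a \in S); case: (b \in S); rewrite ?andbF ?andbT.
    rewrite -sum_nat_const big_distrr /=; apply: leq_sum => w.
    rewrite inE => /and3P[_ g1 g2].
    rewrite -!mulnn -mulnA (mulnCA L (common_nbrs _ _ _ _)) mulnA.
    rewrite /good in g1 g2; rewrite mulnA.
    have := leq_mul g1 g2; lia.
  have hP2 : #|P| <= #|[set t in H4 | m t == (x * y^-1)%g]|.
    (* The four popular quotients telescope to [x * y^-1]. Since [x] is fixed, they determine first
       a, then w, then b. *)
    pose f (u : gT * (gT * gT)) : gT * gT * (gT * gT) :=
      ((x * u.2.1^-1, u.1 * u.2.1^-1), (u.1 * u.2.2^-1, y * u.2.2^-1))%g.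
    apply: (@card_leq_inj _ _ f).
      move=> [w [a b]] [w' [a' b']] _ _ [/mulgI/invg_inj <-].
      by move=> /mulIg <- /mulgI/invg_inj <- _.
    move=> [w [a b]]; rewrite !inE /= => /and5P[_ _ _ /andP[e1 e2] /andP[e3 e4]].
    move: e1 e2 e3 e4; rewrite /e !inE => -> -> -> -> /=.
    by rewrite /m /= !invMg !invgK !mulgA !mulgKV.
  apply: (@leq_trans (2 * #|W| * n ^ 2)); first by rewrite leq_mul2r hW orbT.
  rewrite -2!mulnA leq_mul2l /=; apply: leq_trans hP _.
  by rewrite leq_mul.
have tot : #|(X * X^-1)%g| * (#|N| * n ^ 2) <= 2 * L ^ 2 * #|H| ^ 4.
  rewrite -sum_nat_const.
  apply: (@leq_trans (\sum_(q in (X * X^-1)%g) 2 * L ^ 2 * #|[set t in H4 | m t == q]|)).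
    exact: leq_sum.
  rewrite -big_distrr leq_mul2l; apply/orP; right => /=.
  have -> : #|H| ^ 4 = #|H4| by rewrite !cardsX !mulnn -expnM.
  under eq_bigr do rewrite card_set_sum.
  rewrite exchange_big /= -sum1_card; apply: leq_sum => t tH.
  rewrite (bigID (fun q => q == m t)) /= [X in _ + X]big1 ?addn0; last first.
    by move=> q /andP[_]; rewrite eq_sym => /negbTE ->.
  rewrite -big_mkcondr_idem //= big_mkcond (bigD1 (m t)) //= big1.
    by case: ifP => // _; rewrite ?eqxx.
  by move=> q /negbTE ->; rewrite andbF.
have cH4 : #|H| ^ 4 <= (2 * K * n) ^ 4 by rewrite leq_exp2r.
(* From [tot] and [cH4] come 2 L^2 (2K)^4 = 2^19 K^8; replacing |N| by n / (3K), with 3 <= 4, gives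
   2^21 K^9. The last factor 4K, from n <= 4K |X|, leads to 2^23 K^10. *)
have step : #|(X * X^-1)%g| * n ^ 3 <= 2 ^ 21 * K ^ 9 * n * n ^ 3.
  apply: (@leq_trans (#|(X * X^-1)%g| * (3 * K * #|N| * n ^ 2))).
    by rewrite leq_mul2l expnS leq_mul2r hN !orbT.
  apply: (@leq_trans (3 * K * (2 * L ^ 2 * (2 * K * n) ^ 4))).
    rewrite -mulnA mulnCA leq_mul2l; apply/orP; right.
    by apply: leq_trans tot _; rewrite leq_mul2l cH4 orbT.
  have aux c : 3 <= c ^ 2 -> 3 * K * (c * (c ^ 7 * K ^ 2) ^ 2 * (c * K * n) ^ 4)
      <= c ^ 21 * K ^ 9 * n * n ^ 3.
    move=> c3; apply: (@leq_trans (c ^ 2 * K * (c * (c ^ 7 * K ^ 2) ^ 2 * (c * K * n) ^ 4))).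
      by rewrite leq_mul // leq_mul2r c3 orbT.
    by apply: eq_leq; ring.
  by rewrite LE; apply: (aux 2).
have e23 : 2 ^ 23 = 4 * 2 ^ 21 by rewrite -[4]/(2 ^ 2) -expnD.
move: e23 step; move: (2 ^ 21) (2 ^ 23) => u _ ->.
rewrite leq_pmul2r ?expn_gt0 ?n0 // => step.
apply: leq_trans step _; rewrite -mulnA.
apply: (@leq_trans (u * (K ^ 9 * (4 * K * #|X|)))).
  by rewrite !leq_mul2l hX2 !orbT.
by rewrite (expnSr K 9); move: (K ^ 9) => v; lia.
Qed.

(** * Tao's approximate group of popular right quotients b^-1 c *)

Definition popular (gT : finGroupType) (X : {set gT}) (K : nat) : {set gT} :=
  [set d | #|X| <= 2 * K * #|[set b in X | (b * d)%g \in X]|].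

Lemma one_in_popular (gT : finGroupType) (X : {set gT}) (K : nat) :
  0 < K -> (1%g : gT) \in popular X K.
Proof.
move=> K0; rewrite inE (_ : [set b in X | _] = X); last first.
  by apply/setP => b; rewrite inE mulg1 andbb.
by rewrite leq_pmull // muln_gt0.
Qed.

Lemma popularV (gT : finGroupType) (X : {set gT}) (K : nat) :
  ((popular X K)^-1 = popular X K)%g.
Proof.
apply/setP => d; rewrite !inE; congr (_ <= 2 * K * _).
rewrite -(card_imset _ (mulIg d^-1%g)); apply: eq_card => c; apply/imsetP/idP.
  case=> b; rewrite !inE => /andP[bX bdX] ->; rewrite bdX mulgKV; exact: bX.
rewrite !inE => /andP[cX cdX]; exists (c * d)%g; last by rewrite mulgK.
by rewrite !inE cdX mulgK.
Qed.

(** Index [n] stands for products of n + 1 factors from [Q]. *)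
Fixpoint prod_count (gT : finGroupType) (Q : {set gT}) (n : nat) (g : gT) : nat :=
  if n is m.+1 then \sum_(u in Q) prod_count Q m (u^-1 * g)%g else (g \in Q).

Lemma sum_prod_count (gT : finGroupType) (Q : {set gT}) (n : nat) :
  \sum_g prod_count Q n g = #|Q| ^ n.+1.
Proof.
elim: n => [|n IHn] /=; first by rewrite -sum1_card [RHS]big_mkcond.
rewrite exchange_big /= (eq_bigr (fun=> #|Q| ^ n.+1)).
  by rewrite sum_nat_const -expnS.
by move=> u _; rewrite -IHn [RHS](reindex_inj (mulgI u^-1%g)).
Qed.

(* Tao's argument: inserting d = b^-1 c between consecutive factors writes
   a d_1 ... d_n a'^-1 in many ways as a product of n + 1 elements of X X^-1. *)
Lemma prod_count_popular (gT : finGroupType) (X : {set gT}) (K n : nat) (g : gT) :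
  g \in (X * popular X K ^+ n * X^-1)%g ->
  #|X| ^ n <= (2 * K) ^ n * prod_count (X * X^-1)%g n g.
Proof.
elim: n g => [|n IHn] g; first by rewrite expg0 mulg1 /= !expn0 => ->.
rewrite expgS => /mulsgP[_ c /mulsgP[a _ aX /mulsgP[d e dD eD ->] ->] cX ->] /=.
set B := [set b in X | (b * d)%g \in X].
have hB : #|X| <= 2 * K * #|B| by move: dD; rewrite inE.
set Q := (X * X^-1)%g.
have inj : injective (fun b => a * b^-1)%g by move=> b b' /mulgI/invg_inj.
apply: (@leq_trans ((2 * K) ^ n.+1 *
    \sum_(u in [set a * b^-1 | b in B]%g) prod_count Q n (u^-1 * (a * (d * e) * c))%g)).
  rewrite big_imset /=; last by move=> b b' _ _; apply: inj.
  rewrite expnS; apply: leq_trans (leq_mul hB (leqnn _)) _.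
  rewrite expnS -[leqLHS]mulnA -[leqRHS]mulnA leq_mul2l -sum_nat_const big_distrr /=; apply/orP; right.
  apply: leq_sum => b; rewrite inE => /andP[bX bdX]; apply: IHn.
  rewrite invMg invgK !mulgA mulgKV mem_mulg // mem_mulg //.
rewrite leq_mul2l [leqRHS](bigID (mem [set a * b^-1 | b in B]%g)) /=.
apply/orP; right; apply: leq_trans (leq_addr _ _).
rewrite [leqRHS](eq_bigl (mem [set a * b^-1 | b in B]%g)) // => u /=.
rewrite andb_idl // => /imsetP[b]; rewrite inE => /andP[bX _] ->.
by rewrite mem_mulg // inE invgK.
Qed.

(** Conjugation by some x in X embeds D^n in X D^n X^-1. There every element has at least (|X| /
    2K)^n representations, out of the |X X^-1|^(n+1) available tuples. *)
Lemma card_popular_exp (gT : finGroupType) (X : {set gT}) (K n : nat) :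
  0 < #|X| -> #|(X * X^-1)%g| <= K * #|X| ->
  #|(popular X K ^+ n)%g| <= (2 * K) ^ n * K ^ n.+1 * #|X|.
Proof.
move=> X0 hX; set D := popular X K; set Q := (X * X^-1)%g in hX.
have [x xX] : exists x, x \in X by apply/set0Pn; rewrite -card_gt0.
have DX : #|(D ^+ n)%g| <= #|(X * D ^+ n * X^-1)%g|.
  apply: (@card_leq_inj _ _ (fun d => x * d * x^-1)%g).
    by move=> d d' _ _ /mulIg/mulgI.
  by move=> d dD; rewrite !mem_mulg // inE invgK.
rewrite -(leq_pmul2r (m := #|X| ^ n)) ?expn_gt0 ?X0 //.
apply: leq_trans (leq_mul DX (leqnn _)) _; rewrite -sum_nat_const.
apply: (@leq_trans ((2 * K) ^ n * #|Q| ^ n.+1)).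
  rewrite -sum_prod_count big_distrr /=.
  rewrite [leqRHS](bigID (mem (X * D ^+ n * X^-1)%g)) /=.
  apply: leq_trans (leq_addr _ _); apply: leq_sum => g; exact: prod_count_popular.
rewrite -!mulnA leq_mul2l -expnS -expnMn; apply/orP; right.
by rewrite leq_exp2r.
Qed.

(** The number of a in X with a b^-1 c in X, summed over b and c, is the energy of X, which is at
    least |X|^3 / K by Cauchy-Schwarz on the support X X^-1. Pairs whose right quotient b^-1 c is
    unpopular account for at most half of it, so some b has many popular partners. *)
Lemma popular_translate (gT : finGroupType) (X : {set gT}) (K : nat) :
  0 < #|X| -> #|(X * X^-1)%g| <= K * #|X| ->
  exists2 b, b \in X & #|X| <= 2 * K * #|X :&: (b *: popular X K)%g|.
Proof.
move=> X0 hX; set D := popular X K; set n := #|X| in X0 hX *.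
pose r (d : gT) := #|[set a in X | (a * d)%g \in X]|.
have E1 : n ^ 3 <= K * \sum_(b in X) \sum_(c in X) r (b^-1 * c)%g.
  have -> : \sum_(b in X) \sum_(c in X) r (b^-1 * c)%g = mul_energy X.
    rewrite /mul_energy /quot_count.
    under [RHS]eq_bigr do rewrite card_set_sum -mulnn big_distrlr /=.
    rewrite [RHS]exchange_big; apply: eq_bigr => b bX /=.
    rewrite [RHS]exchange_big; apply: eq_bigr => c cX /=.
    rewrite [RHS](reindex_inj (mulIg b^-1%g)) /r card_set_sum /= big_mkcond.
    by apply: eq_bigr => a _; rewrite mulgKV mulgA; case: (_ \in X); case: (_ \in X).
  set Q := (X * X^-1)%g in hX.
  have sQ : \sum_(h in Q) quot_count X h = n ^ 2.
    rewrite sum_quot_count_in (eq_bigr (fun=> n)) ?sum_nat_const ?mulnn //.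
    move=> z zX; apply: eq_card => x; rewrite !inE andb_idr // => xX.
    by rewrite mem_mulg // inE invgK.
  have := sum_sqr_leq_card Q (quot_count X); rewrite sQ => cs.
  have : n * n ^ 3 <= n * (K * mul_energy X).
    rewrite (_ : n * n ^ 3 = (n ^ 2) ^ 2); last by rewrite -expnM -expnS.
    apply: leq_trans cs _; rewrite mulnA [n * K]mulnC leq_mul //.
    by rewrite /mul_energy [leqRHS](bigID (mem Q)) leq_addr.
  by rewrite leq_pmul2l.
have rn d : r d <= n by apply/subset_leq_card/subsetP => x; rewrite inE => /andP[].
have E2 b : 2 * K * \sum_(c in X) r (b^-1 * c)%g
    <= n ^ 2 + n * (2 * K * #|X :&: (b *: D)%g|).
  rewrite (bigID (fun c => c \in (b *: D)%g)) /= mulnDr addnC leq_add //.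
    rewrite -mulnn [leqRHS](_ : _ = \sum_(c in X) n); last by rewrite sum_nat_const.
    rewrite big_distrr [leqRHS](bigID (fun c => c \in (b *: D)%g)) /=.
    apply: leq_trans (leq_addl _ _); apply: leq_sum => c /andP[_].
    by rewrite mem_lcoset inE -ltnNge => /ltnW.
  rewrite mulnCA leq_mul2l; apply/orP; right.
  rewrite -sum1_card big_distrr /= (eq_bigl (fun c => c \in X :&: (b *: D)%g)).
    by apply: leq_sum => c _; rewrite muln1.
  by move=> c; rewrite inE.
apply/exists_inP; rewrite -[X in is_true X]negbK negb_exists_in.
apply/negP => /forall_inP lt.
have : 2 * (n ^ 3) < n ^ 3 + n ^ 3.
  apply: leq_ltn_trans (leq_mul (leqnn 2) E1) _; rewrite mulnA big_distrr /=.
  apply: leq_ltn_trans (leq_sum _ (fun b _ => E2 b)) _.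
  rewrite big_split sum_nat_const /= -expnS ltn_add2l -big_distrr /=.
  rewrite [n ^ 3]expnS ltn_pmul2l // -mulnn -sum_nat_const.
  have [b bX] : exists b, b \in X by apply/set0Pn; rewrite -card_gt0.
  rewrite (bigD1 b) //= [ltnRHS](bigD1 b) //= -addSn leq_add //.
    by rewrite ltnNge lt.
  by apply: leq_sum => c /andP[cX _]; rewrite ltnW // ltnNge lt.
by rewrite mul2n -addnn ltnn.
Qed.

Local Open Scope ring_scope.

(** * Two-by-two matrices *)

Lemma ord2E (i : 'I_2) : i = 0 \/ i = 1.
Proof. by case: i => -[|[|//]] h; [left|right]; apply: val_inj. Qed.

Lemma mx2_eq (F : fieldType) (x y : 'M[F]_2) :
  x 0 0 = y 0 0 -> x 0 1 = y 0 1 -> x 1 0 = y 1 0 -> x 1 1 = y 1 1 -> x = y.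
Proof.
by move=> h00 h01 h10 h11; apply/matrixP => i j; case: (ord2E i) => ->;
  case: (ord2E j) => ->.
Qed.

Lemma cv2_eq (F : fieldType) (u v : 'cV[F]_2) :
  u 0 0 = v 0 0 -> u 1 0 = v 1 0 -> u = v.
Proof.
by move=> h0 h1; apply/matrixP => i j; rewrite (ord1 j); case: (ord2E i) => ->.
Qed.

Lemma mul2E (F : fieldType) n (x : 'M[F]_2) (y : 'M[F]_(2, n)) i j :
  (x *m y) i j = x i 0 * y 0 j + x i 1 * y 1 j.
Proof.
by rewrite mxE !big_ord_recl big_ord0 addr0; congr (_ + x i _ * y _ j); apply: val_inj.
Qed.

Lemma tr2E (F : fieldType) (x : 'M[F]_2) : \tr x = x 0 0 + x 1 1.
Proof.
by rewrite /mxtrace !big_ord_recl big_ord0 addr0; congr (_ + x _ _); apply: val_inj.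
Qed.

Lemma det2E (F : fieldType) (x : 'M[F]_2) : \det x = x 0 0 * x 1 1 - x 0 1 * x 1 0.
Proof.
rewrite (expand_det_row _ 0) !big_ord_recl big_ord0 addr0 /cofactor !det_mx11 !mxE /=.
rewrite expr0 expr1 mul1r mulN1r mulrN; congr (_ * x _ _ - x _ _ * x _ _); exact: val_inj.
Qed.

Lemma add2E (F : fieldType) m n (x y : 'M[F]_(m, n)) i j : (x + y) i j = x i j + y i j.
Proof. exact: mxE. Qed.

Lemma opp2E (F : fieldType) m n (x : 'M[F]_(m, n)) i j : (- x) i j = - x i j.
Proof. exact: mxE. Qed.

Lemma scale2E (F : fieldType) m n c (x : 'M[F]_(m, n)) i j : (c *: x) i j = c * x i j.
Proof. exact: mxE. Qed.

Lemma one2E (F : fieldType) : ((1%:M : 'M[F]_2) 0 0 = 1) * ((1%:M : 'M[F]_2) 0 1 = 0)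
  * ((1%:M : 'M[F]_2) 1 0 = 0) * ((1%:M : 'M[F]_2) 1 1 = 1).
Proof. by rewrite !mxE. Qed.

Lemma zero2E (F : fieldType) m n i j : (0 : 'M[F]_(m, n)) i j = 0.
Proof. exact: mxE. Qed.

Definition mx2E := (add2E, opp2E, scale2E, mul2E, tr2E, det2E, one2E, zero2E).

Definition nonscalar (F : fieldType) (x : 'M[F]_2) : bool :=
  [|| x 0 1 != 0, x 1 0 != 0 | x 0 0 != x 1 1].

Lemma scalar2E (F : fieldType) (x : 'M[F]_2) : ~~ nonscalar x -> x = x 0 0 *: 1%:M.
Proof.
rewrite !negb_or !negbK => /and3P[/eqP h01 /eqP h10 /eqP h].
by apply: mx2_eq; rewrite !mx2E ?mulr1 ?mulr0.
Qed.

Lemma regular_nonscalar (F : fieldType) (x : 'M[F]_2) :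
  \det x = 1 -> (\tr x) ^+ 2 != 4 -> nonscalar x.
Proof.
move=> dx; apply: contraR => /scalar2E xE; move: dx; rewrite xE !mx2E => dx.
apply/eqP; rewrite !mulr1; transitivity (4 * (x 0 0 * 1 * (x 0 0 * 1) - x 0 0 * 0 * (x 0 0 * 0))).
  by ring.
by rewrite dx mulr1.
Qed.

(** Modulo scalars a matrix is the vector of its entries 01, 10 and the difference 00 - 11. The
    entries of the commutator are the 2x2 minors of two such vectors, so commuting means being
    proportional; a nonzero coordinate of g gives the factor b. *)
Lemma commutant2 (F : fieldType) (g z : 'M[F]_2) :
  nonscalar g -> g *m z = z *m g -> exists a b, z = a *: 1%:M + b *: g.
Proof.
move=> gns comm.
have e00 := congr1 (fun m : 'M[F]_2 => m 0 0) comm.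
have e01 := congr1 (fun m : 'M[F]_2 => m 0 1) comm.
have e10 := congr1 (fun m : 'M[F]_2 => m 1 0) comm.
rewrite /= !mx2E in e00 e01 e10.
move: gns e00 e01 e10; rewrite /nonscalar.
move gaE: (g 0 0) => ga; move gbE: (g 0 1) => gb; move gcE: (g 1 0) => gc.
move gdE: (g 1 1) => gd; move zaE: (z 0 0) => za; move zbE: (z 0 1) => zb.
move zcE: (z 1 0) => zc; move zdE: (z 1 1) => zd => gns e00 e01 e10.
have r1 : gb * zc = zb * gc by apply: (addrI (ga * za)); rewrite e00; ring.
have r2 : gb * (za - zd) = zb * (ga - gd).
  apply: subr0_eq; transitivity ((za * gb + zb * gd) - (ga * zb + gb * zd)); first by ring.
  by rewrite e01 subrr.
have r3 : gc * (za - zd) = zc * (ga - gd).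
  apply: subr0_eq; transitivity ((gc * za + gd * zc) - (zc * ga + zd * gc)); first by ring.
  by rewrite e10 subrr.
have [gb0|gb0] := eqVneq gb 0; last first.
  exists (za - zb / gb * ga), (zb / gb); apply: mx2_eq; rewrite !mx2E ?gaE ?gbE ?gcE ?gdE
    ?zaE ?zbE ?zcE ?zdE; [ring | by field | | ].
  - by apply: (mulfI gb0); rewrite r1; field.
  - by apply: (mulfI gb0); transitivity (gb * za - gb * (za - zd)); [ring | rewrite r2; field].
have [gc0|gc0] := eqVneq gc 0; last first.
  exists (za - zc / gc * ga), (zc / gc); apply: mx2_eq; rewrite !mx2E ?gaE ?gbE ?gcE ?gdE
    ?zaE ?zbE ?zcE ?zdE; [ring | | by field | ].
  - by apply: (mulfI gc0); rewrite mulrC -r1; field.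
  - by apply: (mulfI gc0); transitivity (gc * za - gc * (za - zd)); [ring | rewrite r3; field].
move: gns r2 r3; rewrite gb0 gc0 eqxx /= !mul0r => gns r2 r3.
have gad : ga - gd != 0 by rewrite subr_eq0.
have zb0 : zb = 0 by apply/eqP; move/esym/eqP: r2; rewrite mulf_eq0 (negbTE gad) orbF.
have zc0 : zc = 0 by apply/eqP; move/esym/eqP: r3; rewrite mulf_eq0 (negbTE gad) orbF.
exists (za - (za - zd) / (ga - gd) * ga), ((za - zd) / (ga - gd)).
by apply: mx2_eq; rewrite !mx2E ?gaE ?gbE ?gcE ?gdE ?zaE ?zbE ?zcE ?zdE ?zb0 ?zc0
  ?gb0 ?gc0; [ring | ring | ring | field].
Qed.

Lemma commutant2_comm (F : fieldType) (g z h : 'M[F]_2) :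
  nonscalar g -> g *m z = z *m g -> g *m h = h *m g -> z *m h = h *m z.
Proof.
move=> gns /(commutant2 gns)[a [b ->]] gh.
by rewrite mulmxDl mulmxDr -!scalemxAl -!scalemxAr mul1mx mulmx1 gh.
Qed.

Lemma cayley2 (F : fieldType) (x : 'M[F]_2) : x *m x = \tr x *: x - \det x *: 1%:M.
Proof. by apply: mx2_eq; rewrite !mx2E; ring. Qed.

(** For z = a + b g with t = tr g, completing the square gives 4 det z = (tr z)^2 + b^2 (4 - t^2).
    Determinant and trace therefore fix b up to sign; the other sign is the conjugate of z in F[g],
    which is its inverse. *)
Lemma regular_commutant_trace (F : fieldType) (g z z' : 'M[F]_2) :
  (2 : F) != 0 -> \det g = 1 -> (\tr g) ^+ 2 != 4 -> g *m z = z *m g -> g *m z' = z' *m g ->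
  \det z = 1 -> \det z' = 1 -> \tr z = \tr z' -> z' = z \/ z *m z' = 1%:M.
Proof.
move=> n2 dg tg cz cz' dz dz' tzz'; have gns := regular_nonscalar dg tg.
have [a [b zE]] := commutant2 gns cz; have [a' [b' zE']] := commutant2 gns cz'.
set t := \tr g in tg; rewrite zE zE' in dz dz' tzz' *.
have tE c d : \tr (c *: 1%:M + d *: g) = 2 * c + d * t.
  by rewrite /t !mx2E; ring.
have dE c d : \det (c *: 1%:M + d *: g) = c * c + c * d * t + d * d.
  transitivity (c * c + c * d * t + d * d * \det g); last by rewrite dg mulr1.
  by rewrite /t !mx2E; ring.
rewrite !tE in tzz'; rewrite !dE in dz dz'.
have key c d : 4 * (c * c + c * d * t + d * d) =
    (2 * c + d * t) * (2 * c + d * t) + d * d * (4 - t ^+ 2) by ring.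
have h : b * b * (4 - t ^+ 2) = b' * b' * (4 - t ^+ 2).
  apply: (addrI ((2 * a + b * t) * (2 * a + b * t))).
  by rewrite -(key a b) dz tzz' -(key a' b') dz'.
have t4 : 4 - t ^+ 2 != 0 by rewrite subr_eq0 eq_sym.
have /eqP : (b' - b) * (b' + b) = 0.
  by apply: (mulIf t4); rewrite mul0r; transitivity (b' * b' * (4 - t ^+ 2) - b * b * (4 - t ^+ 2));
    [ring | rewrite h subrr].
rewrite mulf_eq0 => /orP[/eqP/subr0_eq bE|/eqP/addr0_eq bE].
  left; congr (_ *: _ + _ *: _) => //; apply: (mulfI n2).
  by apply: (addIr (b * t)); rewrite tzz' bE.
right; have aE : a' = a + b * t.
  apply: (mulfI n2); apply: (addIr (b' * t)); rewrite -tzz' -bE; ring.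
have bE' : b' = - b by rewrite -bE opprK.
have CH : g *m g = t *: g - 1%:M by rewrite cayley2 dg scale1r.
rewrite mulmxDl !mulmxDr -!scalemxAl -!scalemxAr mul1mx !mulmx1 mul1mx CH.
transitivity ((a * a + a * b * t + b * b) *: 1%:M : 'M[F]_2); last by rewrite dz scale1r.
by rewrite bE' aE; apply: mx2_eq; rewrite !mx2E; ring.
Qed.

(* With n_i = (y_i 0 0 - y_i 1 1, y_i 1 0, y_i 0 1), the hypotheses say that v and v' are
   orthogonal to n_1 and n_2, so both are multiples of n_1 x n_2, which is nonzero because
   its entries are those of the commutator of y_1 and y_2. *)
Lemma traceless_orthogonal_line (F : fieldType) (y1 y2 v v' : 'M[F]_2) :
  y1 *m y2 != y2 *m y1 -> v != 0 ->
  \tr v = 0 -> \tr (v *m y1) = 0 -> \tr (v *m y2) = 0 ->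
  \tr v' = 0 -> \tr (v' *m y1) = 0 -> \tr (v' *m y2) = 0 ->
  exists s, v' = s *: v.
Proof.
move=> ncomm v0 tv tv1 tv2 tv' tv1' tv2'.
pose w := y1 *m y2 - y2 *m y1.
have par u : \tr u = 0 -> \tr (u *m y1) = 0 -> \tr (u *m y2) = 0 ->
    [/\ u 0 0 * w 0 1 = u 0 1 * w 0 0, u 0 0 * w 1 0 = u 1 0 * w 0 0
      & u 0 1 * w 1 0 = u 1 0 * w 0 1].
  rewrite !mx2E => tu tu1 tu2; have uE : u 1 1 = - u 0 0 by apply/esym/addr0_eq.
  rewrite uE in tu1 tu2; split; apply: subr0_eq.
  - transitivity ((y2 0 1) * (u 0 0 * y1 0 0 + u 0 1 * y1 1 0 + (u 1 0 * y1 0 1 - u 0 0 * y1 1 1))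
      - y1 0 1 * (u 0 0 * y2 0 0 + u 0 1 * y2 1 0 + (u 1 0 * y2 0 1 - u 0 0 * y2 1 1))).
      by ring.
    by rewrite -!mulNr tu1 tu2; ring.
  - transitivity (- (y2 1 0) * (u 0 0 * y1 0 0 + u 0 1 * y1 1 0 + (u 1 0 * y1 0 1 - u 0 0 * y1 1 1))
      + y1 1 0 * (u 0 0 * y2 0 0 + u 0 1 * y2 1 0 + (u 1 0 * y2 0 1 - u 0 0 * y2 1 1))).
      by ring.
    by rewrite -!mulNr tu1 tu2; ring.
  - transitivity ((y2 0 0 - y2 1 1) * (u 0 0 * y1 0 0 + u 0 1 * y1 1 0 + (u 1 0 * y1 0 1 - u 0 0 * y1 1 1))
      - (y1 0 0 - y1 1 1) * (u 0 0 * y2 0 0 + u 0 1 * y2 1 0 + (u 1 0 * y2 0 1 - u 0 0 * y2 1 1))).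
      by ring.
    by rewrite -!mulNr tu1 tu2; ring.
have w11 : w 1 1 = - w 0 0 by rewrite /w !mx2E; ring.
have w0 : w != 0 by rewrite subr_eq0.
clearbody w.
have mult u : \tr u = 0 -> \tr (u *m y1) = 0 -> \tr (u *m y2) = 0 -> exists s, u = s *: w.
  move=> tu tu1 tu2; have [p1 p2 p3] := par u tu tu1 tu2.
  have u11 : u 1 1 = - u 0 0 by apply/esym/addr0_eq; rewrite -tr2E.
  move: w0.
  have [w00|w00] := eqVneq (w 0 0) 0; last first.
    move=> _; exists (u 0 0 / w 0 0); apply: mx2_eq; rewrite !mx2E.
    - by field.
    - by apply: (mulIf w00); rewrite -p1; field.
    - by apply: (mulIf w00); rewrite -p2; field.
    - by rewrite u11 w11; field.
  have [w01|w01] := eqVneq (w 0 1) 0; last first.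
    have u00 : u 0 0 = 0 by apply: (mulIf w01); rewrite p1 w00 mulr0 mul0r.
    move=> _; exists (u 0 1 / w 0 1); apply: mx2_eq; rewrite !mx2E.
    - by rewrite w00 u00 mulr0.
    - by field.
    - by apply: (mulIf w01); rewrite -p3; field.
    - by rewrite u11 w11 w00 u00; ring.
  have [w10|w10] := eqVneq (w 1 0) 0; last first.
    have u00 : u 0 0 = 0 by apply: (mulIf w10); rewrite p2 w00 mulr0 mul0r.
    move=> _; exists (u 1 0 / w 1 0); apply: mx2_eq; rewrite !mx2E.
    - by rewrite w00 u00 mulr0.
    - by apply: (mulIf w10); rewrite p3 w01; ring.
    - by field.
    - by rewrite u11 w11 w00 u00; ring.
  by case/eqP; apply: mx2_eq; rewrite ?w11 ?w00 ?w01 ?w10 !mx2E ?oppr0.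
have [s vE] := mult v tv tv1 tv2; have [s' vE'] := mult v' tv' tv1' tv2'.
have s0 : s != 0 by apply: contraNneq v0 => s0; rewrite vE s0 scale0r.
by exists (s' / s); rewrite vE' vE scalerA divfK.
Qed.

(** As a polynomial in s, det (x + s v) - det x has leading coefficient det v and vanishes at 0 and
    1, so it equals det v * s (s - 1). *)
Lemma det2_line (F : fieldType) (x v : 'M[F]_2) s :
  \det (x + v) = \det x -> \det (x + s *: v) = \det x ->
  [\/ s = 0, s = 1 | \det v = 0].
Proof.
rewrite !mx2E => h1 hs.
have /eqP : s * ((s - 1) * (v 0 0 * v 1 1 - v 0 1 * v 1 0)) = 0.
  transitivity (((x 0 0 + s * v 0 0) * (x 1 1 + s * v 1 1)
      - (x 0 1 + s * v 0 1) * (x 1 0 + s * v 1 0))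
    - s * ((x 0 0 + v 0 0) * (x 1 1 + v 1 1) - (x 0 1 + v 0 1) * (x 1 0 + v 1 0))
    + (s - 1) * (x 0 0 * x 1 1 - x 0 1 * x 1 0)); first by ring.
  by rewrite h1 hs; ring.
rewrite !mulf_eq0 subr_eq0 => /or3P[/eqP|/eqP|/eqP]; by [constructor 1|constructor 2|constructor 3].
Qed.

(** The trace conditions confine the three points to an affine line, on which the determinant is a
    quadratic polynomial. It takes the same value at three points, so its leading coefficient
    vanishes. *)
Lemma three_points_on_line (F : fieldType) (y1 y2 x x' x'' : 'M[F]_2) :
  y1 *m y2 != y2 *m y1 ->
  \det x = \det x' -> \det x = \det x'' -> \tr x = \tr x' -> \tr x = \tr x'' ->
  \tr (x *m y1) = \tr (x' *m y1) -> \tr (x *m y1) = \tr (x'' *m y1) ->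
  \tr (x *m y2) = \tr (x' *m y2) -> \tr (x *m y2) = \tr (x'' *m y2) ->
  x' != x -> x'' != x -> x'' != x' ->
  \det (x' - x) = 0 /\ exists s, x'' - x = s *: (x' - x).
Proof.
move=> nc d d' t t' t1 t1' t2 t2' n n' n''.
have [|||||||s sE] := @traceless_orthogonal_line F y1 y2 (x' - x) (x'' - x) nc.
- by rewrite subr_eq0.
- by rewrite linearB /= t subrr.
- by rewrite mulmxBl linearB /= t1 subrr.
- by rewrite mulmxBl linearB /= t2 subrr.
- by rewrite linearB /= t' subrr.
- by rewrite mulmxBl linearB /= t1' subrr.
- by rewrite mulmxBl linearB /= t2' subrr.
split; last by exists s.
have [||s0|s1|//] := @det2_line F x (x' - x) s.
- by rewrite addrC subrK.
- by rewrite -sE addrC subrK.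
- by move: n'; rewrite -subr_eq0 sE s0 scale0r eqxx.
- by move/eqP: n''; case; move: sE; rewrite s1 scale1r => /addIr.
Qed.

(** Polarisation: det (x + v) = det x + det v + tr x tr v - tr (v x). *)
Lemma trace_of_det_add (F : fieldType) (x v : 'M[F]_2) :
  \tr v = 0 -> \det v = 0 -> \det (x + v) = \det x -> \tr (v *m x) = 0.
Proof.
rewrite !mx2E => tv dv dxv.
transitivity ((x 0 0 + x 1 1) * (v 0 0 + v 1 1) + (v 0 0 * v 1 1 - v 0 1 * v 1 0)
  - (((x 0 0 + v 0 0) * (x 1 1 + v 1 1) - (x 0 1 + v 0 1) * (x 1 0 + v 1 0))
     - (x 0 0 * x 1 1 - x 0 1 * x 1 0))); first by ring.
by rewrite dxv tv dv; ring.
Qed.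

(** Such a v is a column w times a row f with f w = 0, and tr (v y) = f (y w). Its vanishing puts y
    w in the kernel of f, which is the line of w. *)
Lemma nilpotent_eigen (F : fieldType) (v y : 'M[F]_2) :
  v != 0 -> \tr v = 0 -> \det v = 0 -> \tr (v *m y) = 0 -> exists l, y *m v = l *: v.
Proof.
rewrite !mx2E => v0 tv dv tvy.
have v11 : v 1 1 = - v 0 0 by apply/esym/addr0_eq.
have bc : v 0 1 * v 1 0 = - (v 0 0 * v 0 0).
  by move: dv; rewrite v11 => /subr0_eq <-; ring.
rewrite v11 in tvy.
have h10 : v 0 1 * y 1 0 = v 0 0 * y 1 1 - v 0 0 * y 0 0 - v 1 0 * y 0 1.
  by apply: subr0_eq; rewrite -tvy; ring.
have [b0|b0] := eqVneq (v 0 1) 0; last first.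
  exists ((y 0 0 * v 0 1 - y 0 1 * v 0 0) / v 0 1).
  apply: mx2_eq; rewrite !mx2E ?v11; apply: (mulfI b0).
  - transitivity (v 0 1 * (y 0 0 * v 0 0) + y 0 1 * (v 0 1 * v 1 0)); first by ring.
    by rewrite bc; field.
  - by field.
  - transitivity ((v 0 1 * y 1 0) * v 0 0 + y 1 1 * (v 0 1 * v 1 0)); first by ring.
    rewrite h10 bc; transitivity (y 0 0 * (v 0 1 * v 1 0) - y 0 1 * v 0 0 * v 1 0).
      by rewrite bc; ring.
    by field.
  - transitivity ((v 0 1 * y 1 0) * v 0 1 - y 1 1 * v 0 0 * v 0 1); first by ring.
    rewrite h10; transitivity (- v 0 0 * y 0 0 * v 0 1 - y 0 1 * (v 0 1 * v 1 0)); first by ring.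
    by rewrite bc; field.
have a0 : v 0 0 = 0.
  by apply/eqP; move/eqP: bc; rewrite b0 mul0r eq_sym oppr_eq0 mulf_eq0 orbb.
have c0 : v 1 0 != 0.
  by apply: contraNneq v0 => c0; apply/eqP/mx2_eq; rewrite !mx2E ?v11 ?a0 ?oppr0.
have y01 : y 0 1 = 0.
  apply: (mulfI c0); rewrite mulr0 -tvy a0 b0; ring.
exists (y 1 1); apply: mx2_eq; rewrite !mx2E ?v11 ?a0 ?b0 ?y01; ring.
Qed.

Lemma det2_kernel (F : fieldType) (x v : 'M[F]_2) : v != 0 -> x *m v = 0 -> \det x = 0.
Proof.
move=> v0 xv; apply: contraNeq v0 => dx.
have xu : x \in unitmx by rewrite unitmxE unitfE.
by rewrite -[v](mulKmx xu) xv mulmx0.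
Qed.

(** The number of columns is left free because [v] is sometimes an eigenvector and sometimes a
    nilpotent matrix whose columns are eigenvectors. *)
Lemma eigen_charpoly2 (F : fieldType) n (x : 'M[F]_2) (v : 'M[F]_(2, n)) l :
  v != 0 -> \det x = 1 -> x *m v = l *: v -> l * l - \tr x * l + 1 = 0.
Proof.
move=> v0 dx xv.
have CH : x *m x = \tr x *: x - 1%:M by rewrite cayley2 dx scale1r.
apply/eqP; have : (l * l - \tr x * l + 1) *: v == 0.
  rewrite !scalerDl scaleNr scale1r -!scalerA -xv scalemxAr -xv mulmxA CH mulmxBl.
  by rewrite mul1mx -scalemxAl [_ - v]addrC addrK addNr.
by rewrite scaler_eq0 (negbTE v0) orbF.
Qed.

Lemma quadratic_roots (F : fieldType) (t a b c : F) :
  a * a - t * a + 1 = 0 -> b * b - t * b + 1 = 0 -> c * c - t * c + 1 = 0 ->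
  [\/ a = b, a = c | b = c].
Proof.
move=> ha hb hc; have [->|ab] := eqVneq a b; first by constructor 1.
have [->|ac] := eqVneq a c; first by constructor 2.
constructor 3; rewrite -subr_eq0 in ab; rewrite -subr_eq0 in ac.
have sab : a + b = t.
  apply: (mulfI ab); apply: subr0_eq.
  by transitivity ((a * a - t * a + 1) - (b * b - t * b + 1)); [ring | rewrite ha hb subrr].
have sac : a + c = t.
  apply: (mulfI ac); apply: subr0_eq.
  by transitivity ((a * a - t * a + 1) - (c * c - t * c + 1)); [ring | rewrite ha hc subrr].
by apply: (addrI a); rewrite sab sac.
Qed.

Lemma same_eigen_det0 (F : fieldType) (x x' v : 'M[F]_2) l l' :
  v != 0 -> x *m v = l *: v -> x' *m v = l' *: v -> l = l' -> \det (x - x') = 0.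
Proof. by move=> v0 e e' ll; apply: (det2_kernel v0); rewrite mulmxBl e e' ll subrr. Qed.

(* If x, x y1, x y2 have the same trace and lie on a common degenerate line, they share an
   eigenvector, and two of the three eigenvalues agree since all are roots of z^2 - t z + 1. *)
Lemma common_eigen_triple (F : fieldType) (x y1 y2 v : 'M[F]_2) :
  v != 0 -> \tr v = 0 -> \det v = 0 -> \det (x + v) = \det x ->
  \tr (v *m y1) = 0 -> \tr (v *m y2) = 0 ->
  \det x = 1 -> \det (x *m y1) = 1 -> \det (x *m y2) = 1 ->
  \tr (x *m y1) = \tr x -> \tr (x *m y2) = \tr x ->
  [\/ \det (x - x *m y1) = 0, \det (x - x *m y2) = 0 | \det (x *m y1 - x *m y2) = 0].
Proof.
move=> v0 tv dv dxv t1 t2 dx d1 d2 e1 e2.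
have tx := trace_of_det_add tv dv dxv.
have [l xl] := nilpotent_eigen v0 tv dv tx.
have [m1 ym1] := nilpotent_eigen v0 tv dv t1.
have [m2 ym2] := nilpotent_eigen v0 tv dv t2.
have x1 : x *m y1 *m v = (m1 * l) *: v by rewrite -mulmxA ym1 -scalemxAr xl scalerA.
have x2 : x *m y2 *m v = (m2 * l) *: v by rewrite -mulmxA ym2 -scalemxAr xl scalerA.
have r := eigen_charpoly2 v0 dx xl.
have := eigen_charpoly2 v0 d1 x1; rewrite e1 => r1.
have := eigen_charpoly2 v0 d2 x2; rewrite e2 => r2.
have [e|e|e] := quadratic_roots r r1 r2.
- by constructor 1; apply: (same_eigen_det0 v0 xl x1).
- by constructor 2; apply: (same_eigen_det0 v0 xl x2).
- by constructor 3; apply: (same_eigen_det0 v0 x1 x2).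
Qed.

(** If y1 is not scalar then y2 = a + b y1, and equal nonzero traces force a + b = 1. So x, x y1, x
    y2 are collinear with equal determinants, and [det2_line] applies. A scalar y1 must be 1, again
    because the trace is nonzero. *)
Lemma commuting_triple (F : fieldType) (x y1 y2 : 'M[F]_2) :
  \tr x != 0 -> y1 *m y2 = y2 *m y1 ->
  \det x = 1 -> \det (x *m y1) = 1 -> \det (x *m y2) = 1 ->
  \tr (x *m y1) = \tr x -> \tr (x *m y2) = \tr x ->
  [\/ \det (x - x *m y1) = 0, \det (x - x *m y2) = 0 | \det (x *m y1 - x *m y2) = 0].
Proof.
move=> tx comm dx d1 d2 e1 e2.
case ns : (nonscalar y1); last first.
  move/negbT/scalar2E: ns => yE; constructor 1; move: (y1 0 0) yE => c yE.
  have c1 : c = 1.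
    by apply: (mulIf tx); rewrite mul1r -[RHS]e1 yE -scalemxAr mulmx1 mxtraceZ.
  by rewrite yE c1 scale1r mulmx1 subrr det0.
have [a [b y2E]] := commutant2 ns comm.
have x2E : x *m y2 = a *: x + b *: (x *m y1).
  by rewrite y2E mulmxDr -!scalemxAr mulmx1.
have ab : a = 1 - b.
  apply: (mulIf tx); apply: (addIr (b * \tr x)).
  move: e2; rewrite x2E linearD /= !mxtraceZ e1 => ->; ring.
have x2E' : x *m y2 = x + b *: (x *m y1 - x).
  by rewrite x2E ab scalerBl scale1r scalerBr addrA addrAC.
have [||b0|b1|dv] := @det2_line F x (x *m y1 - x) b.
- by rewrite addrC subrK d1.
- by rewrite -x2E' d2.
- by constructor 2; rewrite x2E' b0 scale0r addr0 subrr det0.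
- by constructor 3; rewrite x2E' b1 scale1r [x + _]addrC subrK subrr det0.
- by constructor 1; rewrite -opprB -scaleN1r detZ dv mulr0.
Qed.

Lemma agree_on_two_vectors (F : fieldType) (x y : 'M[F]_2) (u v : 'cV[F]_2) :
  u != 0 -> x *m u = y *m u -> x *m v = y *m v -> (exists a, v = a *: u) \/ x = y.
Proof.
move=> u0 xu xv; have [D0|D0] := eqVneq (u 0 0 * v 1 0 - v 0 0 * u 1 0) 0.
  left; have [u00|u00] := eqVneq (u 0 0) 0.
    have u10 : u 1 0 != 0.
      by apply: contraNneq u0 => u10; apply/eqP/cv2_eq; rewrite !mx2E.
    have v00 : v 0 0 = 0.
      by apply/eqP; move/eqP: D0; rewrite u00 mul0r sub0r oppr_eq0 mulf_eq0 (negbTE u10) orbF.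
    by exists (v 1 0 / u 1 0); apply: cv2_eq; rewrite !mx2E ?divfK // v00 u00 mulr0.
  exists (v 0 0 / u 0 0); apply: cv2_eq; rewrite !mx2E ?divfK //.
  by apply: (mulfI u00); rewrite (subr0_eq D0); field.
right; pose m : 'M[F]_2 := \matrix_(i, j) (if j == 0 then u i 0 else v i 0).
have mE : (m 0 0 = u 0 0) * (m 0 1 = v 0 0) * (m 1 0 = u 1 0) * (m 1 1 = v 1 0).
  by rewrite !mxE.
clearbody m.
have mu : m \in unitmx by rewrite unitmxE unitfE det2E !mE.
have cm : x *m m = y *m m.
  have cu0 := congr1 (fun w : 'cV[F]_2 => w 0 0) xu.
  have cu1 := congr1 (fun w : 'cV[F]_2 => w 1 0) xu.
  have cv0 := congr1 (fun w : 'cV[F]_2 => w 0 0) xv.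
  have cv1 := congr1 (fun w : 'cV[F]_2 => w 1 0) xv.
  rewrite /= !mx2E in cu0 cu1 cv0 cv1.
  by apply: mx2_eq; rewrite !mx2E !mE.
by rewrite -[x](mulmxK mu) cm mulmxK.
Qed.

Lemma eigenline2 (F : fieldType) (x : 'M[F]_2) l (w w' : 'cV[F]_2) :
  nonscalar x -> w != 0 -> x *m w = l *: w -> x *m w' = l *: w' ->
  exists a, w' = a *: w.
Proof.
move=> ns w0 e e'; have lE (z : 'cV[F]_2) : (l *: 1%:M) *m z = l *: z.
  by rewrite -scalemxAl mul1mx.
have [||//|xE] := @agree_on_two_vectors F x (l *: 1%:M) w w' w0; rewrite ?lE //.
by move: ns; rewrite xE /nonscalar !mx2E !mulr0 !eqxx.
Qed.

(** The difference x' - x is nilpotent. Its image is an eigenline of x by [nilpotent_eigen] and is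
    killed by x' - x, so x' has the same eigenvalue there. *)
Lemma unipotent_quotient_eigen (F : fieldType) (x x' : 'M[F]_2) :
  \det x = 1 -> \det x' = 1 -> \tr x = \tr x' -> \det (x' - x) = 0 -> x' != x ->
  exists2 w : 'cV[F]_2, w != 0 & exists l, x *m w = l *: w /\ x' *m w = l *: w.
Proof.
move=> dx dx' tt; have [v vE] : exists v, v = x' - x by exists (x' - x).
rewrite -subr_eq0 -vE => dv v0.
have tv : \tr v = 0 by rewrite vE linearB /= tt subrr.
have tx : \tr (v *m x) = 0.
  by apply: trace_of_det_add => //; rewrite vE addrC subrK dx dx'.
have [l xl] := nilpotent_eigen v0 tv dv tx.
have [j vj] : exists j, col j v != 0.
  apply/existsP; apply: contraNT v0; rewrite negb_exists => /forallP h.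
  apply/eqP/matrixP => i j; have := h j; rewrite negbK => /eqP/matrixP/(_ i 0).
  by rewrite !mxE.
have vv : v *m v = 0 by rewrite cayley2 tv dv !scale0r subrr.
have colE (y : 'M[F]_2) : y *m col j v = col j (y *m v) by rewrite !colE mulmxA.
exists (col j v) => //; exists l; rewrite !colE xl.
have -> : x' *m v = l *: v by rewrite -xl -[x'](subrK x) -vE mulmxDl vv add0r.
by rewrite linearZ.
Qed.


Definition mx2 (F : fieldType) (a b c d : F) : 'M[F]_2 :=
  \matrix_(i, j) if i == 0 then (if j == 0 then a else b) else (if j == 0 then c else d).

Lemma mx2VE (F : fieldType) (a b c d : F) :
  (mx2 a b c d 0 0 = a) * (mx2 a b c d 0 1 = b) * (mx2 a b c d 1 0 = c) *
  (mx2 a b c d 1 1 = d).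
Proof. by rewrite !mxE. Qed.

Lemma det_mx2 (F : fieldType) (a b c d : F) : \det (mx2 a b c d) = a * d - b * c.
Proof. by rewrite det2E !mx2VE. Qed.

Lemma elementary_moves_line (F : fieldType) (u : 'cV[F]_2) : u != 0 ->
  exists2 m : 'M[F]_2, \det m = 1 & forall c : F, m *m u != c *: u.
Proof.
move=> u0; have [u1|u1] := eqVneq (u 1 0) 0.
  exists (mx2 1 0 1 1); first by rewrite det_mx2; ring.
  move=> c; apply: contraNneq u0 => e.
  have := congr1 (fun w : 'cV[F]_2 => w 1 0) e.
  rewrite /= !mx2E !mx2VE u1 mulr0 mul1r addr0 mulr0 => u00.
  by apply/eqP/cv2_eq; rewrite !mx2E.
exists (mx2 1 1 0 1); first by rewrite det_mx2; ring.
move=> c; apply: contraNneq (u1) => e.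
have := congr1 (fun w : 'cV[F]_2 => w 1 0) e; have := congr1 (fun w : 'cV[F]_2 => w 0 0) e.
rewrite /= !mx2E !mx2VE !mul1r mul0r add0r => e0 e1.
have c1 : c = 1 by apply: (mulIf u1); rewrite mul1r -e1.
by apply/eqP; apply: (addrI (u 0 0)); rewrite e0 c1 mul1r addr0.
Qed.

Lemma elementary_noncommuting (F : fieldType) :
  exists m n : 'M[F]_2, [/\ \det m = 1, \det n = 1 & m *m n != n *m m].
Proof.
exists (mx2 1 0 1 1), (mx2 1 1 0 1); split; [by rewrite det_mx2; ring.. |].
apply/negP => /eqP/(congr1 (fun m : 'M[F]_2 => m 0 0)).
rewrite /= !mx2E !mx2VE !mulr1 mulr0 addr0 => /eqP.
by rewrite -subr_eq0 opprD addNKr oppr_eq0 oner_eq0.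
Qed.

Lemma det0_kernel_vector (F : fieldType) (v : 'M[F]_2) : \det v = 0 ->
  exists2 w : 'cV[F]_2, w != 0 & v *m w = 0.
Proof.
rewrite -det_tr => /eqP/det0P[w w0 wv]; exists w^T; first by rewrite trmx_eq0.
by apply: trmx_inj; rewrite trmx_mul trmxK trmx0.
Qed.

(** * Growth in SL_2(F_p) *)

Definition mat (p : nat) (g : {'GL_2['F_p]}) : 'M['F_p]_2 := GLval g.

Lemma mat_inj (p : nat) : injective (@mat p).
Proof. exact: val_inj. Qed.

Lemma mat1 (p : nat) : mat (1%g : {'GL_2['F_p]}) = 1%:M.
Proof. by rewrite /mat GL_1E. Qed.

Lemma matM (p : nat) (g h : {'GL_2['F_p]}) : mat (g * h)%g = mat g *m mat h.
Proof. by rewrite /mat GL_MxE. Qed.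

Lemma matVK (p : nat) (g : {'GL_2['F_p]}) : mat g^-1%g *m mat g = 1%:M.
Proof. by rewrite -matM mulVg mat1. Qed.

Lemma det_mat (p : nat) (g : {'GL_2['F_p]}) : g \in SL2 p -> \det (mat g) = 1.
Proof. by rewrite inE => /eqP. Qed.

Lemma tr_matJ (p : nat) (g h : {'GL_2['F_p]}) : \tr (mat (h * g * h^-1)%g) = \tr (mat g).
Proof. by rewrite !matM mxtrace_mulC mulmxA matVK mul1mx. Qed.

Lemma mat_commute (p : nat) (g h : {'GL_2['F_p]}) :
  (mat g *m mat h == mat h *m mat g) = (g \in 'C[h]%g).
Proof.
rewrite -!matM; apply/eqP/cent1P => [/mat_inj/esym //|c].
by congr mat; exact: esym.
Qed.

(** Non-invertible matrices go to the identity; the value matters only at determinant 1. *)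
Definition SL2_of (p : nat) (m : 'M['F_p]_2) : {'GL_2['F_p]} :=
  if @idP (m \in unitmx) is ReflectT mu then FinRing.Unit mu else 1%g.

Lemma mat_SL2_of (p : nat) (m : 'M['F_p]_2) : \det m = 1 -> mat (SL2_of m) = m.
Proof.
move=> dm; have mu : m \in unitmx by rewrite unitmxE dm unitr1.
by rewrite /mat /SL2_of; case: {-}_ / idP.
Qed.

Lemma SL2_ofP (p : nat) (m : 'M['F_p]_2) : \det m = 1 -> SL2_of m \in SL2 p.
Proof.
by move=> dm; rewrite inE; apply/eqP; rewrite -[X in X = _]/(\det (mat _)) mat_SL2_of.
Qed.

(** In a finite group the generated subgroup is a power of [1 |: A], so words without inverses reach
    all of it. *)
Lemma gen_mul_ind (gT : finGroupType) (A : {set gT}) (Q : gT -> Prop) :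
  Q 1%g -> (forall a h, a \in A -> Q h -> Q (a * h)%g) ->
  forall h, h \in <<A>>%g -> Q h.
Proof.
move=> Q1 QM h; have [n ->] := gen_expgs A; elim: n h => [|n IHn] h.
  by rewrite expg0 => /set1P ->.
rewrite expgS => /mulsgP[a b]; rewrite in_setU1 => /orP[/eqP ->|aA] /IHn Qb ->.
  by rewrite mul1g.
exact: QM.
Qed.

Lemma exp_subset (gT : finGroupType) (A : {set gT}) m n :
  (1%g : gT) \in A -> (m <= n)%N -> (A ^+ m)%g \subset (A ^+ n)%g.
Proof.
move=> A1 /subnK <-; elim: (n - m)%N => [|k IHk]; first by rewrite add0n.
by rewrite addSn expgS; apply/subsetP => x /(subsetP IHk) xA; rewrite -[x]mul1g mem_mulg.
Qed.

Lemma exp_mem1 (gT : finGroupType) (A : {set gT}) x : x \in A -> x \in (A ^+ 1)%g.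
Proof. by rewrite expg1. Qed.

Lemma exp_memM (gT : finGroupType) (A : {set gT}) m n x y :
  x \in (A ^+ m)%g -> y \in (A ^+ n)%g -> (x * y)%g \in (A ^+ (m + n))%g.
Proof. by rewrite expgD; apply: mem_mulg. Qed.

Lemma exp_memV (gT : finGroupType) (A : {set gT}) n x :
  (A^-1)%g = A -> x \in (A ^+ n)%g -> x^-1%g \in (A ^+ n)%g.
Proof.
move=> AV; elim: n x => [|n IHn] x; first by rewrite expg0 !inE => /eqP ->; rewrite invg1.
rewrite expgS => /mulsgP[a b aA bA ->]; rewrite invMg -expgS expgSr mem_mulg ?IHn //.
by rewrite -mem_invg AV.
Qed.

Lemma exp_sub_group (gT : finGroupType) (G : {group gT}) (A : {set gT}) n :
  A \subset G -> (A ^+ n)%g \subset G.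
Proof.
move=> AG; elim: n => [|n IHn]; first by rewrite expg0 sub1G.
by rewrite expgS mul_subG.
Qed.

Lemma SL2_moves_line (p : nat) (u : 'cV['F_p]_2) : u != 0 ->
  exists2 g, g \in SL2 p & forall c : 'F_p, mat g *m u != c *: u.
Proof.
case/elementary_moves_line => m dm hm; exists (SL2_of m); first exact: SL2_ofP.
by rewrite mat_SL2_of.
Qed.

Lemma SL2_not_abelian (p : nat) : ~~ abelian (SL2 p).
Proof.
have [m [n [dm dn mn]]] := elementary_noncommuting 'F_p.
apply/negP => abS; have /(subsetP abS) := SL2_ofP dn.
rewrite -sub_cent1 => /subsetP/(_ _ (SL2_ofP dm)).
by rewrite -mat_commute (mat_SL2_of dm) (mat_SL2_of dn) (negbTE mn).
Qed.

(** A line preserved by every generator would be preserved by the whole of SL_2. *)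
Lemma generator_moves_line (p : nat) (A : {set {'GL_2['F_p]}}) (u : 'cV['F_p]_2) :
  <<A>>%g = SL2 p -> u != 0 -> exists2 a, a \in A & forall c : 'F_p, mat a *m u != c *: u.
Proof.
move=> genA u0; have [g gS gu] := SL2_moves_line u0.
pose moves (a : {'GL_2['F_p]}) := [forall c : 'F_p, mat a *m u != c *: u].
have [/exists_inP[a aA /forallP au]|] := boolP [exists a in A, moves a]; first by exists a.
rewrite negb_exists_in => /forall_inP h.
suff: exists c : 'F_p, mat g *m u = c *: u by case=> c e; case/eqP: (gu c).
rewrite -genA in gS; apply: (@gen_mul_ind _ A (fun h => exists c : 'F_p, mat h *m u = c *: u) _ _ g gS)
  => [|a b aA [c bu]].
  by exists 1; rewrite mat1 mul1mx scale1r.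
have := h a aA; rewrite negb_forall => /existsP[d]; rewrite negbK => /eqP au.
by exists (c * d); rewrite matM -mulmxA bu -scalemxAr au scalerA.
Qed.

Lemma generators_noncommuting (p : nat) (A : {set {'GL_2['F_p]}}) :
  <<A>>%g = SL2 p ->
  exists2 a, a \in A & exists2 b, b \in A & mat a *m mat b != mat b *m mat a.
Proof.
move=> genA; have := SL2_not_abelian p; rewrite -genA abelian_gen /abelian.
case/subsetPn => a aA /centP nc; exists a => //.
apply/exists_inP; rewrite -[X in is_true X]negbK negb_exists_in.
apply/negP => /forall_inP h; apply: nc => b bA.
by apply: mat_inj; have := h b bA; rewrite negbK !matM => /eqP.
Qed.

(** * Stabilisers of vectors *)

Definition fixer (p : nat) (u : 'cV['F_p]_2) : {set {'GL_2['F_p]}} :=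
  [set g | mat g *m u == u].

Lemma fixerM (p : nat) (u : 'cV['F_p]_2) g h :
  g \in fixer u -> h \in fixer u -> (g * h)%g \in fixer u.
Proof. by rewrite !inE => /eqP gu /eqP hu; rewrite matM -mulmxA hu gu. Qed.

Lemma fixerV (p : nat) (u : 'cV['F_p]_2) g : g \in fixer u -> g^-1%g \in fixer u.
Proof. by rewrite !inE => /eqP gu; rewrite -{1}gu mulmxA matVK mul1mx. Qed.

(* For a moving the line of u, the map (s1, s2) |-> s1 a s2 is injective on fixer u. *)
Lemma card_exp_fixer (p : nat) (A : {set {'GL_2['F_p]}}) (u : 'cV['F_p]_2) k :
  <<A>>%g = SL2 p -> u != 0 ->
  (#|A ^+ k :&: fixer u|%g ^ 2 <= #|(A ^+ (k + (1 + k)))%g|)%N.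
Proof.
move=> genA u0; have [a aA au] := generator_moves_line genA u0.
rewrite -mulnn -cardsX.
pose f (s : {'GL_2['F_p]} * {'GL_2['F_p]}) := (s.1 * (a * s.2))%g.
apply: (@card_leq_inj _ _ f); last first.
  case=> s1 s2; rewrite !inE /= => /andP[/andP[s1A _] /andP[s2A _]].
  by rewrite /f /= !exp_memM // exp_mem1.
move=> [s1 s2] [t1 t2]; rewrite in_setX in_setX !in_setI /=.
move=> /andP[/andP[_ s1u] /andP[_ s2u]] /andP[/andP[_ t1u] /andP[_ t2u]] e.
rewrite /f /= in e.
(* Written in these two ways, the element fixes both u and a u, which are independent; hence it is
   1. *)
have cE : (t1^-1 * s1 = a * (t2 * s2^-1) * a^-1)%g.
  by apply: (mulgI t1); rewrite mulKVg !mulgA -[(t1 * a * t2)%g]mulgA -e !mulgA !mulgK.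
have cu : mat (t1^-1 * s1)%g *m u = 1%:M *m u.
  by rewrite mul1mx; apply/eqP; have := fixerM (fixerV t1u) s1u; rewrite inE.
have cau : mat (t1^-1 * s1)%g *m (mat a *m u) = 1%:M *m (mat a *m u).
  rewrite cE mul1mx mulmxA -matM mulgKV matM -mulmxA.
  by congr (_ *m _); apply/eqP; have := fixerM t2u (fixerV s2u); rewrite inE.
have [[c uE]|c1] := agree_on_two_vectors u0 cu cau; first by case/eqP: (au c).
have e1 : s1 = t1.
  by apply: (mulgI t1^-1%g); apply: mat_inj; rewrite c1 mulVg mat1.
by move: e; rewrite e1 => /mulgI/mulgI ->.
Qed.

Definition max_fixer (p : nat) (X : {set {'GL_2['F_p]}}) : nat :=
  \max_(u : 'cV['F_p]_2 | u != 0) #|X :&: fixer u|.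

Lemma leq_max_fixer (p : nat) (X : {set {'GL_2['F_p]}}) (u : 'cV['F_p]_2) :
  u != 0 -> (#|X :&: fixer u| <= max_fixer X)%N.
Proof. by move=> u0; rewrite /max_fixer (bigD1 u) //= leq_maxl. Qed.

Lemma max_fixer_exp (p : nat) (A : {set {'GL_2['F_p]}}) k :
  <<A>>%g = SL2 p -> (max_fixer (A ^+ k)%g ^ 2 <= #|(A ^+ (k + (1 + k)))%g|)%N.
Proof.
move=> genA; apply: (big_ind (fun m => (m ^ 2 <= #|(A ^+ (k + (1 + k)))%g|)%N)) => //.
  by move=> m n hm hn; case: (leqP m n).
by move=> u u0; apply: card_exp_fixer.
Qed.

(** * Trace classes *)

Definition trace_fiber (p : nat) (X : {set {'GL_2['F_p]}}) (t : 'F_p) :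
  {set {'GL_2['F_p]}} := [set x in X | \tr (mat x) == t].

(** Equivalently, x^-1 y fixes a nonzero vector. *)
Definition degenerate (p : nat) (x y : {'GL_2['F_p]}) : bool :=
  \det (mat x - mat y) == 0.

Lemma degenerateC (p : nat) (x y : {'GL_2['F_p]}) : degenerate x y = degenerate y x.
Proof.
rewrite /degenerate -opprB -scaleN1r detZ.
by rewrite sqrrN expr1n mul1r.
Qed.

(* x^-1 y fixes a common eigenvector of x and y, which lies on one of the at most two
   eigenlines of x. *)
Lemma card_degenerate (p : nat) (A : {set {'GL_2['F_p]}}) (t : 'F_p) (x : {'GL_2['F_p]}) :
  A \subset SL2 p -> (1%g : {'GL_2['F_p]}) \in A -> (A^-1)%g = A -> t ^+ 2 != 4 ->
  x \in trace_fiber (A ^+ 4)%g t ->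
  (#|[set y in trace_fiber (A ^+ 4)%g t | degenerate y x]| <= 2 * max_fixer (A ^+ 8)%g)%N.
Proof.
move=> AS A1 AV t4 xX; set X := trace_fiber _ t in xX *; set m := max_fixer _.
have inX y : y \in X -> [/\ y \in (A ^+ 4)%g, y \in SL2 p & \tr (mat y) = t].
  rewrite inE => /andP[yA /eqP yt]; split=> //; exact: (subsetP (exp_sub_group 4 AS)).
have [xA xS xt] := inX x xX.
have dx := det_mat xS; have xns : nonscalar (mat x) by apply: regular_nonscalar; rewrite ?xt.
set Y := [set y in X | _].
have eig y : y \in Y -> y != x -> exists2 w : 'cV['F_p]_2, w != 0 &
    exists l : 'F_p, mat x *m w = l *: w /\ mat y *m w = l *: w.
  rewrite inE => /andP[yX /eqP dyx] yx; have [yA yS yt] := inX y yX.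
  by apply: unipotent_quotient_eigen; rewrite ?det_mat ?yt ?xt // (inj_eq (@mat_inj p)).
have fixw (w : 'cV['F_p]_2) l y : w != 0 -> mat x *m w = l *: w -> mat y *m w = l *: w ->
    (x^-1 * y)%g \in fixer w.
  move=> w0 xw yw; rewrite inE matM -mulmxA yw -xw mulmxA matVK mul1mx //.
have quotA y : y \in Y -> (x^-1 * y)%g \in (A ^+ 8)%g.
  by rewrite inE => /andP[/inX[yA _ _] _]; rewrite (@exp_memM _ _ 4 4) ?exp_memV.
have le_fix (Z : {set {'GL_2['F_p]}}) (w : 'cV['F_p]_2) : w != 0 -> Z \subset Y ->
    {in Z, forall y, (x^-1 * y)%g \in fixer w} -> (#|Z| <= m)%N.
  move=> w0 ZY hZ; apply: leq_trans (leq_max_fixer _ w0).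
  apply: (@card_leq_inj _ _ (fun y => x^-1 * y)%g); first by move=> y y' _ _ /mulgI.
  by move=> y yZ; rewrite inE hZ // andbT quotA // (subsetP ZY).
have scal (w w' : 'cV['F_p]_2) l y : w != 0 -> w' != 0 -> mat x *m w = l *: w ->
    mat x *m w' = l *: w' -> mat y *m w' = l *: w' -> (x^-1 * y)%g \in fixer w.
  move=> w0 w'0 xw xw' yw'; have [c wE] := eigenline2 xns w'0 xw' xw.
  by apply: (fixw _ l) => //; rewrite wE -scalemxAr yw' scalerA mulrC -scalerA.
have root_l (w : 'cV['F_p]_2) l : w != 0 -> mat x *m w = l *: w -> l * l - t * l + 1 = 0.
  by move=> w0 xw; rewrite -xt; apply: eigen_charpoly2 xw.
have [/exists_inP[y0 y0Y y0x]|] := boolP [exists y in Y, y != x]; last first.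
  rewrite negb_exists_in => /forall_inP h.
  have : (#|Y| <= #|[set x]|)%N.
    by apply/subset_leq_card/subsetP => y /h; rewrite negbK inE.
  have [w w0] : exists w : 'cV['F_p]_2, w != 0.
    by exists (const_mx 1); apply/negP => /eqP/matrixP/(_ 0 0)/eqP; rewrite !mxE oner_eq0.
  (* When [Y] has no element besides x, the bound still needs m > 0, which the identity provides. *)
  have : (#|[set (1%g : {'GL_2['F_p]})]| <= m)%N.
    apply: leq_trans (leq_max_fixer _ w0); apply/subset_leq_card/subsetP => _ /set1P ->.
    by rewrite !inE mat1 mul1mx eqxx andbT (subsetP (exp_subset (m := 1) _ _)) // expg1.
  by rewrite !cards1 => m1 Y1; apply: leq_trans Y1 _; rewrite muln_gt0.
have [w0 w0n [l0 [xw0 yw0]]] := eig _ y0Y y0x.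
(* [Z] belongs to the eigenline of w0. Any other y shares with x an eigenvector whose eigenvalue is
   the second root of the characteristic polynomial, so all of them belong to one further
   eigenline. *)
pose Z := [set y in Y | (x^-1 * y)%g \in fixer w0].
have Z1 : (#|Z| <= m)%N.
  by apply: (le_fix _ w0) => //; [apply/subsetP => y|move=> y]; rewrite inE => /andP[].
suff Z2 : (#|Y :\: Z| <= m)%N.
  by rewrite -(cardsID Z Y) mul2n -addnn leq_add // (leq_trans _ Z1) // subset_leq_card // subsetIr.
have inYZ y : y \in Y :\: Z -> exists2 w : 'cV['F_p]_2, w != 0 &
    exists2 l : 'F_p, l != l0 & mat x *m w = l *: w /\ mat y *m w = l *: w.
  rewrite in_setD => /andP[yZ yY].
  have yx : y != x.
    apply: contraNneq yZ => ->; rewrite inE (_ : x \in Y).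
      by rewrite mulVg inE mat1 mul1mx eqxx.
    by rewrite inE xX /degenerate subrr det0 eqxx.
  have [w wn [l [xw yw]]] := eig _ yY yx; exists w => //; exists l => //.
  by apply: contraNneq yZ => ll; rewrite inE yY; apply: (scal _ w l0); rewrite // -ll.
have [->|[y1 y1Z]] := set_0Vmem (Y :\: Z); first by rewrite cards0.
have [w1 w1n [l1 l10 [xw1 yw1]]] := inYZ _ y1Z.
apply: (le_fix _ w1) => //; first exact: subsetDl.
move=> y yZ; have [w wn [l ll0 [xw yw]]] := inYZ _ yZ.
have [e|e|e] := quadratic_roots (root_l _ _ w0n xw0) (root_l _ _ w1n xw1) (root_l _ _ wn xw).
- by rewrite e eqxx in l10.
- by rewrite e eqxx in ll0.
- by apply: (scal _ w l1); rewrite // e.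
Qed.

(** The map (x, y, z) |-> (x^-1 y, x^-1 z) sends triples of the class to pairs in A^8 and is at most
    two-to-one on triples without a degenerate pair: this is the first term. The second counts the
    triples with a degenerate pair, 2 m |X|^2 for each of the three pairs. *)
Lemma card_trace_fiber (p : nat) (A : {set {'GL_2['F_p]}}) (t : 'F_p) :
  A \subset SL2 p -> (1%g : {'GL_2['F_p]}) \in A -> (A^-1)%g = A -> t != 0 -> t ^+ 2 != 4 ->
  (#|trace_fiber (A ^+ 4)%g t| ^ 3
    <= 2 * #|(A ^+ 8)%g| ^ 2 + 6 * max_fixer (A ^+ 8)%g * #|trace_fiber (A ^+ 4)%g t| ^ 2)%N.
Proof.
move=> AS A1 AV t0 t4; set X := trace_fiber _ t; set m := max_fixer _.
have inX y : y \in X -> [/\ y \in (A ^+ 4)%g, \det (mat y) = 1 & \tr (mat y) = t].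
  rewrite inE => /andP[yA /eqP yt]; split=> //; apply: det_mat.
  exact: (subsetP (exp_sub_group 4 AS)).
pose X3 := setX X (setX X X).
pose bad (u : {'GL_2['F_p]} * ({'GL_2['F_p]} * {'GL_2['F_p]})) :=
  [|| degenerate u.2.1 u.1, degenerate u.2.2 u.1 | degenerate u.2.2 u.2.1].
have cX3 : #|X3| = (#|X| ^ 3)%N by rewrite !cardsX.
have degc x : x \in X -> (\sum_(y in X) degenerate y x <= 2 * m)%N.
  by move=> xX; rewrite -card_set_sum; apply: (card_degenerate (t := t)).
have cbad : (#|[set u in X3 | bad u]| <= 6 * m * #|X| ^ 2)%N.
  rewrite card_set_sum.
  apply: (@leq_trans (\sum_(x in X) \sum_(y in X) \sum_(z in X)
     (degenerate y x + degenerate z x + degenerate z y))%N).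
    rewrite (eq_bigl (fun u : {'GL_2['F_p]} * ({'GL_2['F_p]} * {'GL_2['F_p]}) =>
       (u.1 \in X) && (u.2 \in setX X X))); last by case=> x u; rewrite in_setX.
    rewrite -(pair_big (mem X) (mem (setX X X)) (fun x v => nat_of_bool (bad (x, v)))) /=.
    apply: leq_sum => x _.
    rewrite (eq_bigl (fun v : {'GL_2['F_p]} * {'GL_2['F_p]} =>
       (v.1 \in X) && (v.2 \in X))); last by case=> y z; rewrite in_setX.
    rewrite -(pair_big (mem X) (mem X) (fun y z => nat_of_bool (bad (x, (y, z))))) /=.
    apply: leq_sum => y _; apply: leq_sum => z _; rewrite /bad /=.
    by case: (degenerate y x); case: (degenerate z x); case: (degenerate z y).
  under eq_bigr do under eq_bigr do rewrite !big_split /= sum_nat_const.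
  under eq_bigr do rewrite !big_split /= sum_nat_const -big_distrr /=.
  rewrite !big_split /=.
  have b1 : (\sum_(x in X) #|X| * \sum_(y in X) degenerate y x <= #|X| * (#|X| * (2 * m)))%N.
    by rewrite -[leqRHS]sum_nat_const; apply: leq_sum => x xX; rewrite leq_mul2l degc ?orbT.
  have b2 : (\sum_(x in X) \sum_(y in X) \sum_(z in X) degenerate z y
       <= #|X| * (#|X| * (2 * m)))%N.
    rewrite -[leqRHS]sum_nat_const; apply: leq_sum => x xX.
    by rewrite -sum_nat_const; apply: leq_sum => y yX; apply: degc.
  have -> : (6 * m * #|X| ^ 2 = #|X| * (#|X| * (2 * m)) + #|X| * (#|X| * (2 * m))
      + #|X| * (#|X| * (2 * m)))%N by ring.
  rewrite !leq_add //.
have cgood : (#|[set u in X3 | ~~ bad u]| <= 2 * #|(A ^+ 8)%g| ^ 2)%N.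
  rewrite -mulnn -cardsX.
  pose f (u : {'GL_2['F_p]} * ({'GL_2['F_p]} * {'GL_2['F_p]})) :=
    (u.1^-1 * u.2.1, u.1^-1 * u.2.2)%g.
  apply: (@card_leq_fibers _ _ f).
    case=> x [y z]; rewrite inE in_setX in_setX /= => /andP[/and3P[xX yX zX] _].
    have [xA _ _] := inX x xX; have [yA _ _] := inX y yX; have [zA _ _] := inX z zX.
    by rewrite in_setX /= !(@exp_memM _ _ 4 4) ?exp_memV.
  case=> y1 y2 _; rewrite leqNgt; apply/negP => /card_gt2P.
  case=> -[x [x2 x3]] [[x' [x2' x3']] [[x'' [x2'' x3'']] [[]]]].
  have good v v2 v3 : (v, (v2, v3)) \in [set u in [set u in X3 | ~~ bad u] | f u == (y1, y2)] ->
     [/\ v \in X, (v * y1)%g \in X & (v * y2)%g \in X] /\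
     [/\ v2 = (v * y1)%g, v3 = (v * y2)%g & ~~ bad (v, (v2, v3))].
    rewrite inE inE in_setX in_setX /= => /andP[/andP[/and3P[vX v2X v3X] nb]].
    by case/eqP => <- <-; rewrite !mulKVg.
  move=> /good[[xX xy1 xy2] [-> -> nb]] /good[[x'X x'y1 x'y2] [-> -> _]].
  move=> /good[[x''X x''y1 x''y2] [-> -> _]] [nx nx' nx''].
  have ne v v' : (v, (v * y1, v * y2))%g != (v', (v' * y1, v' * y2))%g -> mat v' != mat v.
    by apply: contraNneq => /mat_inj ->.
  have nbad : ~ [\/ \det (mat x - mat x *m mat y1) = 0,
      \det (mat x - mat x *m mat y2) = 0
    | \det (mat x *m mat y1 - mat x *m mat y2) = 0].
    rewrite -!matM => h; case/negP: nb; rewrite /bad /= ![degenerate _ x]degenerateC.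
    rewrite [degenerate (x * y2) _]degenerateC /degenerate.
    by case: h => ->; rewrite eqxx ?orbT.
  have [_ dx tx] := inX _ xX; have [_ dxy1 txy1] := inX _ xy1.
  have [_ dxy2 txy2] := inX _ xy2; have [_ dx' tx'] := inX _ x'X.
  have [_ _ tx'y1] := inX _ x'y1; have [_ _ tx'y2] := inX _ x'y2.
  have [_ dx'' tx''] := inX _ x''X; have [_ _ tx''y1] := inX _ x''y1.
  have [_ _ tx''y2] := inX _ x''y2.
  rewrite !matM in dxy1 txy1 dxy2 txy2 tx'y1 tx'y2 tx''y1 tx''y2.
  (* If y1 and y2 commute, the single point x already has a degenerate pair. Otherwise the three
     points of the fibre span a line of singular direction x' - x, and [common_eigen_triple] finds
     the degenerate pair. *)
  case: nbad; have [comm|ncomm] := eqVneq (mat y1 *m mat y2) (mat y2 *m mat y1).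
    by apply: commuting_triple => //; rewrite ?tx ?txy1 ?txy2.
  have [|||||||||||dv _] := @three_points_on_line _ (mat y1) (mat y2) (mat x) (mat x') (mat x'') ncomm.
  - by rewrite dx.
  - by rewrite dx.
  - by rewrite tx.
  - by rewrite tx.
  - by rewrite txy1.
  - by rewrite txy1.
  - by rewrite txy2.
  - by rewrite txy2.
  - exact: (ne _ _ nx).
  - by rewrite eq_sym; apply: (ne _ _ nx'').
  - exact: (ne _ _ nx').
  apply: (@common_eigen_triple _ (mat x) (mat y1) (mat y2) (mat x' - mat x)) => //.
  - by rewrite subr_eq0; apply: (ne _ _ nx).
  - by rewrite linearB /= tx tx' subrr.
  - by rewrite addrC subrK dx dx'.
  - by rewrite mulmxBl linearB /= txy1 tx'y1 subrr.
  - by rewrite mulmxBl linearB /= txy2 tx'y2 subrr.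
  - by rewrite txy1.
  - by rewrite txy2.
rewrite -cX3 -(cardsID [set u | bad u] X3) addnC; apply: leq_add.
  by apply: leq_trans cgood; apply/subset_leq_card/subsetP => u; rewrite !inE andbC.
by apply: leq_trans cbad; apply/subset_leq_card/subsetP => u; rewrite !inE.
Qed.

(** The fixer term m satisfies m^2 <= |A^17| <= M |A|. If |X| <= 12 m, then |X|^3 <= 12^3 m^4, where
    M >= 12 absorbs 12^3; otherwise the fixer term is at most half of |X|^3 and |X|^3 <= 4
    |A^8|^2. *)
Lemma card_trace_fiber_small (p M : nat) (A : {set {'GL_2['F_p]}}) (t : 'F_p) :
  <<A>>%g = SL2 p -> (1%g : {'GL_2['F_p]}) \in A -> (A^-1)%g = A -> (12 <= M)%N ->
  (#|(A ^+ 17)%g| <= M * #|A|)%N -> t != 0 -> t ^+ 2 != 4 ->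
  (#|trace_fiber (A ^+ 4)%g t| ^ 3 <= M ^ 5 * #|A| ^ 2)%N.
Proof.
move=> genA A1 AV M12 hM t0 t4; have AS : A \subset SL2 p by rewrite -genA subset_gen.
have := card_trace_fiber AS A1 AV t0 t4; set X := trace_fiber _ t.
have A8 : (#|(A ^+ 8)%g| <= M * #|A|)%N.
  by apply: leq_trans hM; apply/subset_leq_card/exp_subset.
have m2 : (max_fixer (A ^+ 8)%g ^ 2 <= M * #|A|)%N by apply: leq_trans (max_fixer_exp 8 genA) hM.
have a0 : (0 < #|A|)%N by apply/card_gt0P; exists 1%g.
move: (max_fixer _) m2 #|(A ^+ 8)%g| A8 #|X| => m m2 a8 A8 x.
move: #|A| a0 m2 A8 => a a0 m2 A8 h; clear -M12 a0 m2 A8 h.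
have M2 : (M ^ 2 * a ^ 2 * 12 ^ 3 <= M ^ 5 * a ^ 2)%N.
  by rewrite mulnAC (_ : M ^ 5 = M ^ 2 * M ^ 3)%N ?leq_mul ?leq_exp2r // -expnD.
have [xm|mx] := leqP x (12 * m).
  apply: leq_trans M2; apply: (@leq_trans ((12 * m) ^ 3)); first by rewrite leq_exp2r.
  rewrite expnMn mulnC leq_mul2r; apply/orP; right.
  apply: (@leq_trans ((m ^ 2) ^ 2)).
    by case: (m) => [//|k]; rewrite -expnM leq_pexp2l.
  by rewrite -expnMn leq_exp2r.
have a82 : (a8 ^ 2 <= M ^ 2 * a ^ 2)%N by rewrite -expnMn leq_exp2r.
have : (2 * (6 * m * x ^ 2) <= x ^ 3)%N.
  by rewrite mulnA mulnA (expnS x 2) leq_mul2r (ltnW mx) orbT.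
have : (4 * (M ^ 2 * a ^ 2) <= M ^ 2 * a ^ 2 * 12 ^ 3)%N.
  by rewrite mulnC leq_mul2l; apply/orP; right.
move: (6 * m * x ^ 2)%N (x ^ 3)%N (M ^ 2 * a ^ 2)%N (12 ^ 3)%N (M ^ 5 * a ^ 2)%N (a8 ^ 2)%N
  h a82 M2 => c1 c2 c3 c4 c5 c6; clear; lia.
Qed.

(** On SL_2 the second condition says that the eigenvalues are distinct, so that the centraliser is
    a torus. Trace 0 is excluded for the sake of [commuting_triple]. *)
Definition regular (p : nat) (g : {'GL_2['F_p]}) : bool :=
  (\tr (mat g) != 0) && (\tr (mat g) ^+ 2 != 4).

(** Orbit-stabiliser for a |-> a g a^-1: the images lie in one trace class of A^4, and two elements
    with the same image differ by an element of A^2 in the centraliser. Cubing and inserting the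
    bound for the trace class cancels |A|^2. *)
Lemma regular_torus_large (p M : nat) (A : {set {'GL_2['F_p]}}) (g : {'GL_2['F_p]}) :
  <<A>>%g = SL2 p -> (1%g : {'GL_2['F_p]}) \in A -> (A^-1)%g = A -> (12 <= M)%N ->
  (#|(A ^+ 17)%g| <= M * #|A|)%N -> g \in (A ^+ 2)%g -> regular g ->
  (#|A| <= M ^ 5 * #|A ^+ 2 :&: 'C[g]|%g ^ 3)%N.
Proof.
move=> genA A1 AV M12 hM gA /andP[t0 t4].
have := card_trace_fiber_small genA A1 AV M12 hM t0 t4.
set X := trace_fiber _ _; set C := (A ^+ 2 :&: 'C[g])%g => hX.
have AC : (#|A| <= #|C| * #|X|)%N.
  apply: (@card_leq_fibers _ _ (fun a => a * g * a^-1)%g).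
    move=> a /exp_mem1 aA; rewrite inE tr_matJ eqxx andbT.
    exact: (exp_memM (exp_memM aA gA) (exp_memV AV aA)).
  move=> y _; set Y := [set a in A | _].
  have [->|[a0]] := set_0Vmem Y; first by rewrite cards0.
  rewrite inE => /andP[a0A /eqP a0y].
  apply: (@card_leq_inj _ _ (fun a => a0^-1 * a)%g); first by move=> a a' _ _ /mulgI.
  move=> a; rewrite inE => /andP[aA /eqP ay].
  rewrite inE (exp_memM (exp_memV AV (exp_mem1 a0A)) (exp_mem1 aA)) /=; apply/cent1P.
  have ag : (a * g = y * a)%g by rewrite -ay mulgKV.
  have a0g : (a0 * g = y * a0)%g by rewrite -a0y mulgKV.
  by apply: (mulgI a0); rewrite !mulgA mulgV mul1g ag a0g mulgK.
have a0 : (0 < #|A|)%N by apply/card_gt0P; exists 1%g.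
rewrite -(leq_pmul2r (m := #|A| ^ 2)) ?expn_gt0 ?a0 // -expnS.
apply: (@leq_trans ((#|C| * #|X|) ^ 3)); first by rewrite leq_exp2r.
rewrite expnMn mulnC [leqRHS]mulnAC leq_mul2r; apply/orP; right; exact: hX.
Qed.

(* Counting (c, a) |-> c a, whose fibres have at most |A^2 :&: C| points. *)
Lemma card_exp4_subgroup (gT : finGroupType) (A : {set gT}) (C : {group gT}) :
  (1%g : gT) \in A -> (A^-1)%g = A ->
  (#|A ^+ 4 :&: C|%g * #|A| <= #|A ^+ 2 :&: C|%g * #|(A ^+ 5)%g|)%N.
Proof.
move=> A1 AV; rewrite -cardsX.
apply: (@card_leq_fibers _ _ (fun t => t.1 * t.2)%g).
  case=> c a; rewrite in_setX in_setI /= => /andP[/andP[cA _] aA].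
  exact: (exp_memM cA (exp_mem1 aA)).
move=> y _; set Y := [set t in _ | _].
have [->|[[c0 a0]]] := set_0Vmem Y; first by rewrite cards0.
rewrite inE in_setX in_setI /= => /andP[/andP[/andP[c0A c0C] a0A] /eqP c0a0].
apply: (@card_leq_inj _ _ (fun t => a0 * t.2^-1)%g).
  move=> [c a] [c' a']; rewrite inE in_setX /= => /andP[_ /eqP ca].
  rewrite inE in_setX /= => /andP[_ /eqP ca'] /mulgI/invg_inj aa.
  by congr (_, _) => //; apply: (mulIg a); rewrite ca aa ca'.
case=> c a; rewrite inE in_setX in_setI /= => /andP[/andP[/andP[cA cC] aA] /eqP ca].
rewrite in_setI (exp_memM (exp_mem1 a0A) (exp_memV AV (exp_mem1 aA))) /=.
have -> : (a0 * a^-1 = c0^-1 * c)%g.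
  by apply: (mulgI c0); rewrite mulgA c0a0 -ca mulgK mulKVg.
by rewrite groupM ?groupV.
Qed.

Lemma card_torus_trace (p : nat) (g : {'GL_2['F_p]}) (t : 'F_p) :
  (2 : 'F_p) != 0 -> g \in SL2 p -> regular g ->
  (#|[set z in SL2 p :&: 'C[g]%g | \tr (mat z) == t]| <= 2)%N.
Proof.
move=> n2 gS /andP[_ t4]; set Z := [set z in _ | _].
have [->|[z]] := set_0Vmem Z; first by rewrite cards0.
rewrite inE in_setI => /andP[/andP[zS]]; rewrite cent1C -mat_commute => /eqP zg /eqP zt.
have : Z \subset [set z; z^-1]%g.
  apply/subsetP => y; rewrite inE in_setI => /andP[/andP[yS]].
  rewrite cent1C -mat_commute => /eqP yg /eqP yt; rewrite !inE.
  have tzy : \tr (mat z) = \tr (mat y) by rewrite zt yt.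
  have [/mat_inj ->|zy] := regular_commutant_trace n2 (det_mat gS) t4 zg yg (det_mat zS)
    (det_mat yS) tzy.
    by rewrite eqxx.
  apply/orP; right; apply/eqP; apply: (mulgI z); rewrite mulgV.
  by apply: mat_inj; rewrite matM zy mat1.
move/subset_leq_card => h; apply: leq_trans h _; apply: leq_trans (leq_card_setU _ _) _.
by rewrite !cards1.
Qed.

Lemma card_torus (p : nat) (g : {'GL_2['F_p]}) : prime p ->
  (2 : 'F_p) != 0 -> g \in SL2 p -> regular g -> (#|SL2 p :&: 'C[g]%g| <= 2 * p)%N.
Proof.
move=> pp n2 gS gr.
rewrite -[X in (2 * X)%N](card_Fp pp) -cardsT.
apply: (@card_leq_fibers _ _ (fun z => \tr (mat z))); first by move=> z _; rewrite in_setT.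
by move=> t _; apply: card_torus_trace.
Qed.

Lemma irregular_trace (p : nat) (z : {'GL_2['F_p]}) :
  ~~ regular z -> \tr (mat z) \in (0 |: [set 2; -2] : {set 'F_p}).
Proof.
rewrite negb_and !negbK in_setU1 in_set2 => /orP[->//|].
have -> : (4 : 'F_p) = 2 ^+ 2 by ring.
by rewrite eqf_sqr => ->; rewrite orbT.
Qed.

(** There are three irregular traces, 0, 2 and -2, each with at most two elements of the torus. *)
Lemma card_torus_irregular (p : nat) (g : {'GL_2['F_p]}) :
  (2 : 'F_p) != 0 -> g \in SL2 p -> regular g ->
  (#|[set z in SL2 p :&: 'C[g]%g | ~~ regular z]| <= 6)%N.
Proof.
move=> n2 gS gr; pose B : {set 'F_p} := 0 |: [set 2; -2].
apply: (@leq_trans (2 * #|B|)); last first.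
  by rewrite (@leq_mul _ _ 2 3) // !cardsU1 cards1; do 2![case: (_ \notin _)].
apply: (@card_leq_fibers _ _ (fun z => \tr (mat z))).
  by move=> z; rewrite inE => /andP[_ /irregular_trace].
move=> t _; apply: leq_trans (card_torus_trace t n2 gS gr).
by apply/subset_leq_card/subsetP => z; rewrite !inE => /andP[/andP[-> _] ->].
Qed.

(** Otherwise, for non-commuting a and b in A, the traces of x, x a, x b take at most 27 joint
    values as x runs over A. A fibre with three points lies on a line of singular direction; a
    vector in the kernel of this direction is fixed by all quotients within the fibre, so the fibre
    has at most m elements. Then |A| <= 27 (2 + m) with m^2 <= M |A|, too small for |A| > M^5. *)
Lemma exists_regular (p M : nat) (A : {set {'GL_2['F_p]}}) :
  <<A>>%g = SL2 p -> (1%g : {'GL_2['F_p]}) \in A -> (A^-1)%g = A -> (12 <= M)%N ->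
  (#|(A ^+ 17)%g| <= M * #|A|)%N -> (M ^ 5 < #|A|)%N ->
  exists2 g, g \in (A ^+ 2)%g & regular g.
Proof.
move=> genA A1 AV M12 hM hA; have AS : A \subset SL2 p by rewrite -genA subset_gen.
apply/exists_inP; rewrite -[X in is_true X]negbK negb_exists_in.
apply/negP => /forall_inP irr.
have [a aA [b bA nc]] := generators_noncommuting genA.
pose B : {set 'F_p} := 0 |: [set 2; -2].
have cB : (#|B| <= 3)%N by rewrite !cardsU1 cards1; do 2![case: (_ \notin _)].
have inB z : z \in (A ^+ 2)%g -> \tr (mat z) \in B by move/irr/irregular_trace.
have A2 x : x \in A -> x \in (A ^+ 2)%g.
  by move=> xA; rewrite (subsetP (exp_subset (m := 1) A1 _)) // exp_mem1.
set m := max_fixer (A ^+ 2)%g.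
have m2 : (m ^ 2 <= M * #|A|)%N.
  apply: leq_trans (max_fixer_exp 2 genA) _.
  by apply: leq_trans hM; apply/subset_leq_card/exp_subset.
have fib : (#|A| <= (2 + m) * #|setX B (setX B B)|)%N.
  pose f x := (\tr (mat x), (\tr (mat x *m mat a), \tr (mat x *m mat b))).
  apply: (@card_leq_fibers _ _ f).
    move=> x xA; rewrite !in_setX /= -!matM (inB _ (A2 _ xA)).
    rewrite (inB _ (exp_memM (exp_mem1 xA) (exp_mem1 aA))).
    exact: (inB _ (exp_memM (exp_mem1 xA) (exp_mem1 bA))).
  move=> y _; set Y := [set x in A | _].
  have [Y2|/card_gt2P] := leqP #|Y| 2; first by apply: leq_trans Y2 (leq_addr _ _).
  have inY z : z \in Y -> [/\ z \in A, \det (mat z) = 1 & f z = y].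
    by rewrite inE => /andP[zA /eqP]; split=> //; apply: det_mat; apply: (subsetP AS).
  case=> x [x' [x'' [[xY x'Y x''Y] [n n' n'']]]].
  have [xA dx fx] := inY _ xY; have [x'A dx' fx'] := inY _ x'Y.
  have line z : z \in Y -> z != x -> z != x' ->
      \det (mat x' - mat x) = 0 /\ exists s, mat z - mat x = s *: (mat x' - mat x).
    move=> zY zx zx'; have [zA dz fz] := inY _ zY.
    move: (fx'); rewrite -fx => -[t0 t1 t2]; move: (fz); rewrite -fx => -[s0 s1 s2].
    have mne (v w : {'GL_2['F_p]}) : v != w -> mat v != mat w.
      by apply: contra_neq => /mat_inj.
    apply: (@three_points_on_line _ (mat a) (mat b) (mat x) (mat x') (mat z)) => //.
    all: try exact: mne; try by rewrite dx.
    by apply: mne; rewrite eq_sym.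
  have [||d0 _] := line _ x''Y; [by [] | by rewrite eq_sym |].
  have [w w0 vw] := det0_kernel_vector d0.
  apply: leq_trans (leq_addl _ _); apply: leq_trans (leq_max_fixer _ w0).
  apply: (@card_leq_inj _ _ (fun z => x^-1 * z)%g); first by move=> z z' _ _ /mulgI.
  move=> z zY; have [zA _ _] := inY _ zY.
  rewrite in_setI (exp_memM (exp_memV AV (exp_mem1 xA)) (exp_mem1 zA)) /=.
  have xw : mat x' *m w = mat x *m w.
    by apply/eqP; rewrite -subr_eq0 -mulmxBl vw.
  have zw : mat z *m w = mat x *m w.
    have [->//|zx] := eqVneq z x; have [->//|zx'] := eqVneq z x'.
    have [_ [s zE]] := line _ zY zx zx'.
    by apply/eqP; rewrite -subr_eq0 -mulmxBl zE -scalemxAl vw scaler0.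
  by rewrite inE matM -mulmxA zw mulmxA matVK mul1mx.
have c27 : (#|setX B (setX B B)| <= 27)%N by rewrite !cardsX (@leq_mul _ _ 3 9) // (@leq_mul _ _ 3 3).
have {c27} fib : (#|A| <= (2 + m) * 27)%N by apply: leq_trans fib _; rewrite leq_mul2l c27 orbT.
move: #|A| hA m2 fib => n hA m2 fib; clear -M12 hA m2 fib.
(* 81 = 27 * 3 settles m <= 1. For m >= 2 one has 27 (2 + m) <= 54 m, and 54^2 <= M^4. *)
have M2 : (81 <= M ^ 2)%N by rewrite (@leq_exp2r 9 M 2) // (leq_trans _ M12).
have n81 : (81 < n)%N.
  by apply: leq_ltn_trans M2 (leq_ltn_trans _ hA); rewrite leq_pexp2l // (leq_trans _ M12).
have [m1|m1] := leqP m 1; first by lia.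
have : (n ^ 2 <= 54 ^ 2 * (M * n))%N.
  apply: (@leq_trans ((54 * m) ^ 2)); first by rewrite leq_exp2r //; lia.
  by rewrite expnMn leq_mul2l m2 orbT.
rewrite -mulnn mulnA leq_pmul2r; last by lia.
rewrite leqNgt (leq_ltn_trans _ hA) // [(M ^ 5)%N]expnSr leq_mul2r; apply/orP; right.
by rewrite (expnM M 2 2) leq_exp2r // (leq_trans _ M2).
Qed.

(** * Conjugate tori and the pivot argument *)

Definition conjV (gT : finGroupType) (h g : gT) : gT := (h * g * h^-1)%g.

Lemma conj1V (gT : finGroupType) (g : gT) : conjV 1%g g = g.
Proof. by rewrite /conjV mul1g invg1 mulg1. Qed.

Lemma conjMV (gT : finGroupType) (a h g : gT) : conjV (a * h)%g g = conjV a (conjV h g).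
Proof. by rewrite /conjV invMg !mulgA. Qed.

Lemma mem_conjV (gT : finGroupType) (G : {group gT}) (g h : gT) :
  g \in G -> h \in G -> conjV h g \in G.
Proof. by move=> gG hG; rewrite !groupM ?groupV. Qed.

Lemma cent1_conjV (gT : finGroupType) (g h z : gT) :
  (z \in 'C[conjV h g]%g) = (conjV h^-1%g z \in 'C[g]%g).
Proof.
have -> : (conjV h g = g ^ h^-1)%g by rewrite /conjV conjgE invgK mulgA.
by rewrite cent1J mem_conjgV conjgE /conjV invgK mulgA.
Qed.

Lemma tr_mat_conjV (p : nat) (g h : {'GL_2['F_p]}) : \tr (mat (conjV h g)) = \tr (mat g).
Proof. exact: tr_matJ. Qed.

Lemma card_SL2_lower (p : nat) : prime p -> (p ^ 2 * p.-1 <= #|SL2 p|)%N.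
Proof.
move=> pp; pose D : {set 'F_p * ('F_p * 'F_p)} := setX [set~ 0] setT.
have <- : #|D| = (p ^ 2 * p.-1)%N.
  by rewrite cardsX cardsC1 cardsT card_prod !card_Fp // mulnn mulnC.
pose m (t : 'F_p * ('F_p * 'F_p)) := mx2 t.1 t.2.1 t.2.2 ((1 + t.2.1 * t.2.2) / t.1).
have dm t : t \in D -> \det (m t) = 1.
  by rewrite !inE andbT => t0; rewrite det_mx2; field.
apply: (@card_leq_inj _ _ (fun t => SL2_of (m t))); last by move=> t /dm/SL2_ofP.
move=> [a [b c]] [a' [b' c']] tD tD' e.
have {}e : m (a, (b, c)) = m (a', (b', c')) :=
  etrans (esym (mat_SL2_of (dm _ tD))) (etrans (congr1 (@mat p) e) (mat_SL2_of (dm _ tD'))).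
have ea := congr1 (fun x : 'M['F_p]_2 => x 0 0) e.
have eb := congr1 (fun x : 'M['F_p]_2 => x 0 1) e.
have ec := congr1 (fun x : 'M['F_p]_2 => x 1 0) e.
by rewrite /= !mx2VE /= in ea eb ec; rewrite ea eb ec.
Qed.

Definition torus_count (gT : finGroupType) (A : {set gT}) (g : gT) : nat :=
  #|A ^+ 2 :&: 'C[g]|%g.

Lemma torus_countJ (gT : finGroupType) (A : {set gT}) (g a : gT) :
  (A^-1)%g = A -> a \in A ->
  (torus_count A g <= #|A ^+ 4 :&: 'C[conjV a g]|%g)%N.
Proof.
move=> AV aA; apply: (@card_leq_inj _ _ (conjV a)); first by move=> z z' _ _ /mulIg/mulgI.
move=> z; rewrite !in_setI => /andP[zA zC]; rewrite cent1_conjV /conjV invgK.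
rewrite (exp_memM (exp_memM (exp_mem1 aA) zA) (exp_memV AV (exp_mem1 aA))) /=.
by rewrite !mulgA mulVg mul1g mulgKV.
Qed.

Lemma card_conjugators (gT : finGroupType) (G : {group gT}) (z : gT) (D : {set gT}) :
  (#|[set h in G | conjV h^-1%g z \in D]| <= #|G :&: 'C[z]%g| * #|D|)%N.
Proof.
apply: (@card_leq_fibers _ _ (fun h => conjV h^-1%g z)) => [h|y _].
  by rewrite inE => /andP[].
set Y := [set h in _ | _]; have [->|[h0]] := set_0Vmem Y; first by rewrite cards0.
have inY h : h \in Y -> h \in G /\ (z * h)%g = (h * y)%g.
  rewrite inE => /andP[]; rewrite inE => /andP[hG _] /eqP <-; split=> //.
  by rewrite /conjV invgK !mulgA mulgV mul1g.
move=> /inY[h0G h0y].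
apply: (@card_leq_inj _ _ (fun h => h * h0^-1)%g); first by move=> h h' _ _ /mulIg.
move=> h /inY[hG hy]; rewrite in_setI groupM ?groupV //=; apply/cent1P.
by apply: (mulIg h0); rewrite -!mulgA h0y mulKg mulgA -hy !mulgA mulgKV.
Qed.

Lemma card_cent1_conjugators (gT : finGroupType) (G : {group gT}) (g z : gT) (D : {set gT}) :
  z \in G -> (forall h y, y \in G :&: 'C[g]%g -> y = conjV h z -> y \in D) ->
  (#|[set h in G | z \in 'C[conjV h g]%g]| <= #|G :&: 'C[z]%g| * #|D|)%N.
Proof.
move=> zG hD; apply: leq_trans (card_conjugators G z D).
apply/subset_leq_card/subsetP => h; rewrite inE cent1_conjV => /andP[hG hz].
rewrite inE hG (hD h^-1%g) // in_setI hz andbT.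
by apply: mem_conjV => //; rewrite groupV.
Qed.

(** Induction along words in A. Conjugating a rich torus by a in A makes the new torus rich in A^4,
    and [card_exp4_subgroup] brings this back to A^2 at the cost of M. The loss does not accumulate:
    more than 6 elements suffice to find a regular z in the new torus, and [regular_torus_large] at
    z restores the full bound, since the centraliser of z is that torus. *)
Lemma torus_pivot (p M : nat) (A : {set {'GL_2['F_p]}}) (g : {'GL_2['F_p]}) :
  <<A>>%g = SL2 p -> (1%g : {'GL_2['F_p]}) \in A -> (A^-1)%g = A -> (12 <= M)%N ->
  (2 : 'F_p) != 0 ->
  (#|(A ^+ 17)%g| <= M * #|A|)%N -> (M ^ 11 < #|A|)%N -> g \in (A ^+ 2)%g -> regular g ->
  forall h, h \in SL2 p ->
    (#|A| <= M ^ 5 * torus_count A (conjV h g) ^ 3)%N.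
Proof.
move=> genA A1 AV M12 n2 hM hA gA gr h; rewrite -genA.
have AS : A \subset SL2 p by rewrite -genA subset_gen.
pose tau (h : {'GL_2['F_p]}) := torus_count A (conjV h g).
pose Q h := h \in SL2 p /\ (#|A| <= M ^ 5 * tau h ^ 3)%N.
suff: h \in <<A>>%g -> Q h by move=> hQ /hQ[].
move: h; apply: gen_mul_ind => [|a h aA [hS Qh]].
  split; first exact: group1.
  by rewrite /tau conj1V; apply: regular_torus_large.
have ahS : (a * h)%g \in SL2 p by rewrite groupM // (subsetP AS).
split=> //; rewrite /tau conjMV; set g' := conjV a (conjV h g).
have gS : g \in SL2 p by apply: (subsetP (exp_sub_group 2 AS)).
have g'S : g' \in SL2 p := mem_conjV (mem_conjV gS hS) (subsetP AS _ aA).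
have g'r : regular g' by rewrite /regular !tr_mat_conjV.
have up : (tau h <= #|A ^+ 4 :&: 'C[g']|%g)%N.
  exact: torus_countJ.
have down : (tau h <= M * torus_count A g')%N.
  have a0 : (0 < #|A|)%N by apply/card_gt0P; exists 1%g.
  have := card_exp4_subgroup 'C[g']%G A1 AV.
  have A5 : (#|(A ^+ 5)%g| <= M * #|A|)%N.
    by apply: leq_trans hM; apply/subset_leq_card/exp_subset.
  move=> /leq_trans/(_ (leq_mul (leqnn _) A5)); rewrite mulnA leq_pmul2r // mulnC => h4.
  exact: leq_trans up h4.
(* With at most 6 elements the previous torus would have at most 6 M <= M^2, hence |A| <= M^5
   (M^2)^3 = M^11. *)
have tau7 : (6 < torus_count A g')%N.
  rewrite ltnNge; apply/negP => t6; move: hA; rewrite ltnNge; apply/negP/negPn.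
  apply: leq_trans Qh _; apply: (@leq_trans (M ^ 5 * (M ^ 2) ^ 3)); last by rewrite -expnM -expnD.
  rewrite leq_mul2l leq_exp2r //; apply/orP; right; apply: leq_trans down _.
  by rewrite -mulnn leq_mul2l (leq_trans t6) ?orbT // (leq_trans _ M12).
have [z zT zr] : exists2 z, z \in (A ^+ 2 :&: 'C[g'])%g & regular z.
  apply/exists_inP; rewrite -[X in is_true X]negbK negb_exists_in.
  apply/negP => /forall_inP irr; move: tau7; rewrite ltnNge; case/negP.
  apply: leq_trans (card_torus_irregular n2 g'S g'r); apply/subset_leq_card/subsetP => z zT.
  rewrite inE irr // andbT; move: zT; rewrite !in_setI => /andP[zA ->].
  by rewrite (subsetP (exp_sub_group 2 AS)).
move: zT; rewrite in_setI => /andP[zA zC].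
have zS := subsetP (exp_sub_group 2 AS) _ zA.
apply: leq_trans (regular_torus_large genA A1 AV M12 hM zA zr) _.
rewrite leq_mul2l leq_exp2r //; apply/orP; right.
apply/subset_leq_card/setIS/subsetP => y yC.
have [_ zt4] := andP zr.
have zns := regular_nonscalar (det_mat zS) zt4.
rewrite -mat_commute; apply/eqP; apply: (commutant2_comm zns); apply/eqP; rewrite mat_commute.
  by rewrite cent1C.
exact: zC.
Qed.

(** A regular z lies in the torus of h g h^-1 when h^-1 z h lies in that of g. The trace leaves at
    most two values for h^-1 z h, and each is attained on a coset of the centraliser of z, of order
    at most 2p. *)
Lemma card_conjugate_tori (p : nat) (X : {set {'GL_2['F_p]}}) (g : {'GL_2['F_p]}) :
  prime p -> (2 : 'F_p) != 0 -> X \subset SL2 p -> g \in SL2 p -> regular g ->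
  (\sum_(h in SL2 p) #|[set z in X | regular z & z \in 'C[conjV h g]%g]| <= 4 * p * #|X|)%N.
Proof.
move=> pp n2 XS gS gr; under eq_bigr do rewrite card_set_sum.
rewrite exchange_big /= mulnC -sum_nat_const; apply: leq_sum => z zX.
have zS := subsetP XS z zX; rewrite -card_set_sum.
case zr : (regular z); last by rewrite (_ : [set h in _ | _] = set0) ?cards0 //;
  apply/setP => h; rewrite !inE andbF.
pose D := [set y in SL2 p :&: 'C[g]%g | \tr (mat y) == \tr (mat z)].
apply: (@leq_trans (2 * p * #|D|)); last first.
  rewrite (_ : 4 * p = 2 * p * 2)%N; last by rewrite mulnAC.
  by rewrite leq_mul2l (card_torus_trace _ n2 gS gr) orbT.
apply: (@leq_trans (#|SL2 p :&: 'C[z]%g| * #|D|)).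
  apply: (card_cent1_conjugators (G := SL2_group p) (D := D) zS) => h y yT yE.
  by rewrite inE yT yE; apply/eqP; apply: tr_mat_conjV.
by rewrite leq_mul2r (card_torus pp n2 zS zr) orbT.
Qed.

(** Summing over all h gives |SL_2| rho <= 4 p |A^2| for the smallest count rho of regular elements
    in a conjugate torus, hence p^2 rho <= M^2 |A|. Cubing and using |A| <= M^8 rho^3 yields M^14;
    here M^8 is the M^5 of the pivot times M^3 for passing to regular elements. *)
Lemma SL2_growth (p M : nat) (A : {set {'GL_2['F_p]}}) : prime p -> (2 < p)%N ->
  <<A>>%g = SL2 p -> (1%g : {'GL_2['F_p]}) \in A -> (A^-1)%g = A -> (12 <= M)%N ->
  (#|(A ^+ 17)%g| <= M * #|A|)%N ->
  (#|A| <= M ^ 11 \/ p ^ 6 <= M ^ 14 * #|A| ^ 2)%N.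
Proof.
move=> pp p2 genA A1 AV M12 hM; have [|hA] := leqP #|A| (M ^ 11); [by left | right].
have AS : A \subset SL2 p by rewrite -genA subset_gen.
have n2 : (2 : 'F_p) != 0.
  by rewrite -[2]/(2%:R) -(dvdn_pcharf (pchar_Fp pp)) gtnNdvd.
have M0 : (0 < M)%N by apply: leq_trans M12.
have hA5 : (M ^ 5 < #|A|)%N by apply: leq_ltn_trans hA; rewrite leq_pexp2l.
have [g gA gr] := exists_regular genA A1 AV M12 hM hA5.
have gS := subsetP (exp_sub_group 2 AS) _ gA.
have piv := torus_pivot genA A1 AV M12 n2 hM hA gA gr.
pose rho (h : {'GL_2['F_p]}) := #|[set z in (A ^+ 2)%g | regular z & z \in 'C[conjV h g]%g]|.
have hrho h : h \in SL2 p -> (#|A| <= M ^ 8 * rho h ^ 3)%N.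
  move=> hS; apply: leq_trans (piv h hS) _.
  have h'S : conjV h g \in SL2 p := mem_conjV gS hS.
  have h'r : regular (conjV h g) by rewrite /regular tr_mat_conjV.
  have irr := card_torus_irregular n2 h'S h'r.
  rewrite /torus_count; set T := (A ^+ 2 :&: _)%g.
  have T1 : (#|T| <= rho h + 6)%N.
    rewrite -(cardsID [set z | regular z] T) leq_add //.
      apply/subset_leq_card/subsetP => z; rewrite !inE => /andP[/andP[-> ->] ->] //.
    apply: leq_trans irr; apply/subset_leq_card/subsetP => z.
    rewrite in_setD in_setI inE => /andP[zr /andP[zA zC]].
    by rewrite inE in_setI zC zr (subsetP (exp_sub_group 2 AS)).
  have T7 : (6 < #|T|)%N.
    rewrite ltnNge; apply/negP => t6; move: hA; rewrite ltnNge; apply/negP/negPn.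
    apply: leq_trans (piv h hS) _; rewrite /torus_count; apply: (@leq_trans (M ^ 5 * M ^ 3)).
      by rewrite leq_mul2l leq_exp2r // (leq_trans t6) ?orbT // (leq_trans _ M12).
    by rewrite -expnD leq_pexp2l.
  have T2 : (#|T| <= M * rho h)%N.
    apply: (@leq_trans (12 * rho h)); last by rewrite leq_mul2r M12 orbT.
    by move: T1 T7; move: #|T| (rho h) => n m; clear; lia.
  rewrite (_ : M ^ 8 = M ^ 5 * M ^ 3)%N; last by rewrite -expnD.
  by rewrite -mulnA -expnMn leq_mul2l leq_exp2r // T2 orbT.
have [h0 h0S h0min] : exists2 h0, h0 \in SL2 p &
    forall h, h \in SL2 p -> (rho h0 <= rho h)%N.
  have [h0 h0S h0min] := arg_minnP rho (group1 (SL2_group p)).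
  by exists h0.
have tot : (#|SL2 p| * rho h0 <= 4 * p * #|(A ^+ 2)%g|)%N.
  apply: leq_trans (card_conjugate_tori pp n2 (exp_sub_group 2 AS) gS gr).
  by rewrite -sum_nat_const; apply: leq_sum => h hS; apply: h0min.
have A2 : (#|(A ^+ 2)%g| <= M * #|A|)%N.
  by apply: leq_trans hM; apply/subset_leq_card/exp_subset.
have p0 : (0 < p)%N by apply: leq_trans p2.
have key : (p ^ 2 * rho h0 <= M ^ 2 * #|A|)%N.
  rewrite -(leq_pmul2r p0).
  apply: (@leq_trans (2 * (#|SL2 p| * rho h0))).
    rewrite mulnAC [leqRHS]mulnA leq_mul2r; apply/orP; right.
    apply: leq_trans (leq_mul (leqnn 2) (card_SL2_lower pp)).
    by rewrite mulnCA leq_mul2l; apply/orP; right; move: p2; clear; lia.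
  apply: leq_trans (leq_mul (leqnn 2) tot) _.
  apply: (@leq_trans (2 * (4 * p * (M * #|A|)))); first by rewrite !leq_mul2l A2 !orbT.
  rewrite (_ : 2 * (4 * p * (M * #|A|)) = 8 * (M * #|A| * p))%N; last by ring.
  by rewrite -mulnn -!mulnA leq_mul2r (leq_trans _ M12) ?orbT.
have a0 : (0 < #|A|)%N by apply/card_gt0P; exists 1%g.
rewrite -(leq_pmul2r a0).
apply: (@leq_trans (p ^ 6 * (M ^ 8 * rho h0 ^ 3))); first by rewrite leq_mul2l hrho ?orbT.
rewrite (_ : p ^ 6 = (p ^ 2) ^ 3)%N -?expnM // mulnCA expnM -expnMn.
apply: (@leq_trans (M ^ 8 * (M ^ 2 * #|A|) ^ 3)); first by rewrite leq_mul2l leq_exp2r // key orbT.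
by apply: eq_leq; ring.
Qed.

(** The three outcomes are: the popular quotients D of a large X in S generate a proper subgroup, D
    is tiny, or D is almost everything. Each passes from D to S at the cost of a power of K, and K
    >= 2 turns the numerical constants into such powers. *)
Lemma energy_structure : exists N : nat,
  forall (p K : nat) (S : {set {'GL_2['F_p]}}), prime p -> (2 < p)%N -> (2 <= K)%N ->
  (0 < #|S|)%N -> S \subset SL2 p -> (#|S| ^ 3 <= K * mul_energy S)%N ->
  [\/ exists (H : {group {'GL_2['F_p]}}) (g : {'GL_2['F_p]}),
        [/\ H \proper SL2 p, g \in SL2 p & (#|S| <= K ^ N * #|S :&: (g *: H)%g|)%N],
      (#|S| <= K ^ N)%N | (p ^ 6 <= K ^ N * #|S| ^ 2)%N].
Proof.
(* 67 * 18 = 34 * 17 + 33 * 18 + 34 is the exponent of K in the bound of |D^17| by |D|. *)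
have [m hm] : exists m, (67 * 18 <= m)%N by exists (67 * 18)%N.
(* 14 m comes from M^14 with M = K^m, and 200 from squaring |D| <= K^100 |S|; the other two outcomes
   need less. *)
exists (m * 14 + 200)%N => p K S pp p2 K2 S0 SS hE.
have K0 : (0 < K)%N by apply: leq_trans K2.
have powK i j : (i <= j)%N -> (K ^ i <= K ^ j)%N by move=> ij; rewrite leq_pexp2l.
have [X XS [SX XX]] := balog_szemeredi_gowers S0 hE.
have X0 : (0 < #|X|)%N by rewrite lt0n; apply: contraTneq SX => ->; rewrite muln0 -ltnNge.
have {}SX : (#|S| <= K ^ 3 * #|X|)%N.
  apply: leq_trans SX _; rewrite leq_mul2r; apply/orP; right.
  by rewrite expnSr leq_mul2r (@leq_exp2r 2 K 2) // K2 orbT.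
have {}XX : (#|(X * X^-1)%g| <= K ^ 33 * #|X|)%N.
  apply: leq_trans XX _; rewrite leq_mul2r; apply/orP; right.
  by rewrite (expnD K 23 10) leq_mul2r leq_exp2r // K2 orbT.
have K2' : (2 * K ^ 33 <= K ^ 34)%N by rewrite (expnS K 33) leq_mul2r K2 orbT.
set D := popular X (K ^ 33).
have [b bX hb] := popular_translate X0 XX.
have {}hb : (#|X| <= K ^ 34 * #|X :&: (b *: D)%g|)%N.
  by apply: leq_trans hb _; rewrite leq_mul2r K2' orbT.
have hD : (#|X| <= K ^ 34 * #|D|)%N.
  apply: leq_trans hb _; rewrite leq_mul2l; apply/orP; right.
  by rewrite -(card_lcoset D b) subset_leq_card // subsetIr.
have XSL : X \subset SL2 p by apply: subset_trans XS SS.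
have DS : D \subset SL2 p.
  apply/subsetP => d; rewrite inE => hd.
  have : (0 < #|[set c in X | (c * d)%g \in X]|)%N.
    by rewrite lt0n; apply: contraTneq hd => ->; rewrite muln0 -ltnNge.
  case/card_gt0P => c; rewrite inE => /andP[cX cdX].
  by rewrite -(groupMl _ (subsetP XSL _ cX)) (subsetP XSL).
have K33 : (0 < K ^ 33)%N by rewrite expn_gt0 K0.
have D1 : (1%g : {'GL_2['F_p]}) \in D := one_in_popular X K33.
have DV : (D^-1)%g = D by apply: popularV.
have [genD|genD] := eqVneq <<D>>%g (SL2 p); last first.
  constructor 1; exists <<D>>%G, b; split.
  - by rewrite properEneq genD gen_subG.
  - exact: (subsetP XSL).
  apply: leq_trans SX _; apply: (@leq_trans (K ^ 3 * (K ^ 34 * #|X :&: (b *: D)%g|))).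
    by rewrite leq_mul2l hb orbT.
  rewrite mulnA -expnD; apply: leq_mul; first by apply: powK; clear; lia.
  apply/subset_leq_card/setISS => //; apply: mulgS; exact: subset_gen.
have M12 : (12 <= K ^ m)%N.
  apply: (@leq_trans (K ^ 4)); last by apply: powK; apply: leq_trans hm.
  by apply: (@leq_trans (2 ^ 4)) => //; rewrite leq_exp2r.
have hM : (#|(D ^+ 17)%g| <= K ^ m * #|D|)%N.
  apply: leq_trans (card_popular_exp 17 X0 XX) _.
  apply: (@leq_trans ((K ^ 34) ^ 17 * (K ^ 33) ^ 18 * (K ^ 34 * #|D|))).
    by rewrite leq_mul // leq_mul2r leq_exp2r // K2' orbT.
  by rewrite mulnA -!expnM -!expnD leq_mul2r powK ?orbT // (leq_trans _ hm).
have [h|h] := SL2_growth pp p2 genD D1 DV M12 hM.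
  constructor 2; apply: leq_trans SX _.
  apply: (@leq_trans (K ^ 3 * (K ^ 34 * (K ^ m) ^ 11))).
    by rewrite leq_mul2l; apply/orP; right; apply: leq_trans hD _; rewrite leq_mul2l h orbT.
  by rewrite -expnM -!expnD; apply: powK; clear; lia.
constructor 3; apply: leq_trans h _.
have cD : (#|D| <= K ^ 100 * #|S|)%N.
  have := card_popular_exp 1 X0 XX; rewrite expg1 expn1 => h; apply: leq_trans h _.
  apply: leq_mul; last exact: subset_leq_card.
  by rewrite (expnD K 34 66) -expnM leq_mul2r K2' orbT.
apply: (@leq_trans ((K ^ m) ^ 14 * (K ^ 100 * #|S|) ^ 2)).
  by rewrite leq_mul2l leq_exp2r // cD orbT.
by rewrite expnMn -!expnM mulnA -expnD.
Qed.

(** * Unimodular maps returning points of a plane set to it *)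

Lemma sqr_sum_leq_card (R : realDomainType) (I : finType) (A : {set I}) (a : I -> R) :
  (\sum_(i in A) a i) ^+ 2 <= #|A|%:R * \sum_(i in A) a i ^+ 2.
Proof.
have : 0 <= \sum_(i in A) \sum_(j in A) (a i - a j) ^+ 2.
  by apply: sumr_ge0 => i _; apply: sumr_ge0 => j _; apply: sqr_ge0.
set s := \sum_(i in A) a i; set t := \sum_(i in A) a i ^+ 2.
have -> : \sum_(i in A) \sum_(j in A) (a i - a j) ^+ 2 = 2 * (#|A|%:R * t - s ^+ 2).
  transitivity (\sum_(i in A) \sum_(j in A) (a i ^+ 2 + a j ^+ 2 - 2 * (a i * a j))).
    by apply: eq_bigr => i _; apply: eq_bigr => j _; ring.
  under eq_bigr do rewrite sumrB big_split /= sumr_const -!mulr_sumr.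
  rewrite sumrB big_split /= sumr_const sumrMnl -mulr_sumr -mulr_suml -/s -/t -mulr_natl.
  by ring.
by rewrite pmulr_rge0 ?ltr0n // subr_ge0.
Qed.

Definition cross (F : fieldType) (u v : 'cV[F]_2) : F := u 0 0 * v 1 0 - u 1 0 * v 0 0.

Lemma cross_mul (F : fieldType) (m : 'M[F]_2) (u v : 'cV[F]_2) :
  cross (m *m u) (m *m v) = \det m * cross u v.
Proof. by rewrite /cross !mx2E; ring. Qed.

Lemma crossB (F : fieldType) (u v w : 'cV[F]_2) : cross u (v - w) = cross u v - cross u w.
Proof. by rewrite /cross !mx2E; ring. Qed.

Lemma crossZ (F : fieldType) (c : F) (u v : 'cV[F]_2) : cross (c *: u) v = c * cross u v.
Proof. by rewrite /cross !mx2E; ring. Qed.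

Lemma crossC (F : fieldType) (u v : 'cV[F]_2) : cross u v = - cross v u.
Proof. by rewrite /cross; ring. Qed.

Lemma cross_neq0 (F : fieldType) (u : 'cV[F]_2) : u != 0 -> exists v, cross u v != 0.
Proof.
move=> u0; have [u00|u00] := eqVneq (u 0 0) 0.
  exists (\col_i (i == 0)%:R); rewrite /cross !mxE /= u00 mul0r sub0r mulr1 oppr_eq0.
  by apply: contraNneq u0 => u10; apply/eqP/cv2_eq; rewrite !mx2E.
by exists (\col_i (i == 1)%:R); rewrite /cross !mxE /= mulr1 mulr0 subr0.
Qed.

Lemma cross_eq0_line (F : fieldType) (u v : 'cV[F]_2) :
  u != 0 -> cross u v = 0 -> exists c, v = c *: u.
Proof.
rewrite /cross => u0 /subr0_eq e; have [u00|u00] := eqVneq (u 0 0) 0.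
  have u10 : u 1 0 != 0.
    by apply: contraNneq u0 => u10; apply/eqP/cv2_eq; rewrite !mx2E.
  have v00 : v 0 0 = 0.
    by apply/eqP; move/esym/eqP: e; rewrite u00 mul0r mulf_eq0 (negbTE u10).
  by exists (v 1 0 / u 1 0); apply: cv2_eq; rewrite !mx2E ?divfK // v00 u00 mulr0.
exists (v 0 0 / u 0 0); apply: cv2_eq; rewrite !mx2E ?divfK //.
by apply: (mulfI u00); rewrite e; field.
Qed.

Lemma card_cross_level (F : finFieldType) (u : 'cV[F]_2) (c : F) :
  u != 0 -> (#|[set v | cross u v == c]| <= #|F|)%N.
Proof.
move=> u0; have -> : #|F| = #|[set: F]| by rewrite cardsT.
have [u00|u00] := eqVneq (u 0 0) 0.
  have u10 : u 1 0 != 0.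
    by apply: contraNneq u0 => u10; apply/eqP/cv2_eq; rewrite !mx2E.
  apply: (@card_leq_inj _ _ (fun v : 'cV[F]_2 => v 1 0)) => [v w|v _]; last by rewrite in_setT.
  rewrite !inE /cross u00 !mul0r !sub0r => /eqP <- /eqP/oppr_inj/(mulfI u10) e e1.
  by apply: cv2_eq.
apply: (@card_leq_inj _ _ (fun v : 'cV[F]_2 => v 0 0)) => [v w|v _]; last by rewrite in_setT.
rewrite !inE /cross => /eqP <- /eqP e e0; apply: cv2_eq => //.
by apply: (mulfI u00); move: e; rewrite e0 => /addIr.
Qed.

Definition unimodular (F : finFieldType) : {set 'M[F]_2} := [set m | \det m == 1].

(** With z independent of u, m is determined by m z, which lies on the affine line where its cross
    product with v equals that of u and z. *)
Lemma card_unimodular_map (F : finFieldType) (u v : 'cV[F]_2) :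
  u != 0 -> (#|[set m in unimodular F | m *m u == v]| <= #|F|)%N.
Proof.
move=> u0; have [z uz] := cross_neq0 u0.
have [v0|v0] := eqVneq v 0.
  rewrite (_ : [set m in _ | _] = set0) ?cards0 //; apply/setP => m; rewrite !inE.
  apply/negP => /andP[/eqP dm /eqP mu]; case/eqP: uz.
  by rewrite -[LHS]mul1r -dm -cross_mul mu v0 /cross !mx2E !mul0r subrr.
apply: leq_trans (card_cross_level (cross u z) v0).
apply: (@card_leq_inj _ _ (fun m => m *m z)).
  move=> m m'; rewrite !inE => /andP[_ /eqP mu] /andP[_ /eqP m'u] mz.
  have muu : m *m u = m' *m u by rewrite mu m'u.
  have [[c zE]|//] := agree_on_two_vectors u0 muu mz.
  by move: uz; rewrite zE crossC crossZ /cross [u 0 0 * _]mulrC subrr mulr0 oppr0 eqxx.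
by move=> m; rewrite !inE => /andP[/eqP dm /eqP <-]; rewrite cross_mul dm mul1r.
Qed.

Definition cross_count (F : finFieldType) (B : {set 'cV[F]_2}) (y : 'cV[F]_2) (d : F) : nat :=
  #|[set z in B | cross y z == d]|.

Definition cross_energy (F : finFieldType) (B : {set 'cV[F]_2}) (y : 'cV[F]_2) : nat :=
  \sum_d cross_count B y d ^ 2.

Lemma sum_cross_count (F : finFieldType) (B : {set 'cV[F]_2}) (y : 'cV[F]_2) :
  (\sum_d cross_count B y d = #|B|)%N.
Proof.
rewrite -sum1_card (partition_big (cross y) predT) //=; apply: eq_bigr => d _.
by rewrite sum1dep_card; apply: eq_card => z; rewrite !inE.
Qed.

Lemma cross_energyE (F : finFieldType) (B : {set 'cV[F]_2}) (y : 'cV[F]_2) :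
  (cross_energy B y = \sum_(z in B) \sum_(z' in B) (cross y (z - z') == 0)%R)%N.
Proof.
rewrite /cross_energy /cross_count; under eq_bigr do rewrite card_set_sum -mulnn big_distrlr /=.
rewrite exchange_big; apply: eq_bigr => z _ /=; rewrite exchange_big; apply: eq_bigr => z' _ /=.
rewrite (bigD1 (cross y z)) //= big1 => [|d]; last by rewrite eq_sym => /negbTE ->.
by rewrite eqxx mul1n addn0 crossB subr_eq0 eq_sym.
Qed.

Lemma sumPosz (I : finType) (P : pred I) (f : I -> nat) :
  (\sum_(i | P i) f i)%N%:Z = \sum_(i | P i) (f i)%:Z.
Proof. exact: (big_morph Posz PoszD). Qed.

Lemma PoszM_sqr (n : nat) : (n ^ 2)%N%:Z = n%:Z ^+ 2.
Proof. by rewrite -mulnn PoszM expr2. Qed.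

(** A variance: |F| times this is the sum over d of (|F| * [cross_count B y d] - |B|)^2, so it
    vanishes when B is equidistributed over the lines parallel to a nonzero y. *)
Definition cross_excess (F : finFieldType) (B : {set 'cV[F]_2}) (y : 'cV[F]_2) : int :=
  #|F|%:Z * (cross_energy B y)%:Z - (#|B| ^ 2)%N%:Z.

Lemma cross_excessZ (F : finFieldType) (B : {set 'cV[F]_2}) (s : F) (y : 'cV[F]_2) :
  s != 0 -> cross_excess B (s *: y) = cross_excess B y.
Proof.
move=> s0; rewrite /cross_excess !cross_energyE; congr (_ * (Posz _) - _).
by apply: eq_bigr => z _; apply: eq_bigr => z' _; rewrite crossZ mulf_eq0 (negbTE s0).
Qed.

Lemma sum_centered_sqr (I : finType) (q : int) (f : I -> int) (c : int) :
  q = #|I|%:Z -> \sum_i f i = c ->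
  \sum_i (q * f i - c) ^+ 2 = q * (q * (\sum_i f i ^+ 2) - c ^+ 2).
Proof.
move=> qE fc; under eq_bigr do rewrite sqrrB exprMn.
rewrite big_split sumrB /= -mulr_sumr sumr_const -mulr_natl.
under [X in _ - X + _]eq_bigr do rewrite -mulr_natl.
rewrite -mulr_sumr -mulr_suml -mulr_sumr fc (_ : #|I|%:R = q); first by ring.
by rewrite qE natz.
Qed.

Lemma cross_excess_ge0 (F : finFieldType) (B : {set 'cV[F]_2}) (y : 'cV[F]_2) :
  0 <= cross_excess B y.
Proof.
have q0 : 0 < #|F|%:Z by rewrite ltz_nat; apply/card_gt0P; exists 0.
rewrite -(pmulr_rge0 _ q0) /cross_excess /cross_energy.
have := @sum_centered_sqr F #|F|%:Z (fun d => (cross_count B y d)%:Z) #|B|%:Z erefl _.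
rewrite -sumPosz sum_cross_count => /(_ erefl); rewrite sumPosz PoszM_sqr.
under [in X in _ -> X]eq_bigr do rewrite PoszM_sqr.
by move=> <-; apply: sumr_ge0 => d _; apply: sqr_ge0.
Qed.

Lemma card_nonzero_cv2 (F : finFieldType) :
  #|[set w : 'cV[F]_2 | w != 0]| = (#|F|.-1 * #|F|.+1)%N.
Proof.
have -> : [set w : 'cV[F]_2 | w != 0] = ~: [set 0] by apply/setP => w; rewrite !inE.
rewrite cardsCs setCK cards1 card_mx muln1.
have : (0 < #|F|)%N by apply/card_gt0P; exists 0.
by move: #|F| => -[//|q] _; rewrite -mulnn; lia.
Qed.

(** With q = |F|, a pair z = z' is counted by all (q - 1)(q + 1) vectors w, and a pair z != z' only
    by the q - 1 multiples of z - z'. *)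
Lemma sum_cross_energy (F : finFieldType) (B : {set 'cV[F]_2}) :
  (\sum_(w : 'cV[F]_2 | w != 0%R) cross_energy B w <= #|B| * (#|F|.-1 * (#|F| + #|B|)))%N.
Proof.
have q0 : (0 < #|F|)%N by apply/card_gt0P; exists 0.
under eq_bigr do rewrite cross_energyE.
rewrite exchange_big /= -sum_nat_const; apply: leq_sum => z zB; rewrite exchange_big /=.
have off (u : 'cV[F]_2) : u != 0 -> (\sum_(w : 'cV[F]_2 | w != 0%R) (cross w u == 0)%R <= #|F|.-1)%N.
  move=> u0; have := card_cross_level 0 u0; rewrite (cardsD1 0) inE.
  rewrite (_ : cross u 0 == 0); last by rewrite /cross !mx2E !mulr0 subrr.
  rewrite add1n => h; rewrite -ltnS prednK //; apply: leq_trans h; rewrite ltnS.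
  rewrite -sum1_card [leqLHS]big_mkcond [leqRHS]big_mkcond /=; apply: leq_sum => w _.
  by rewrite !inE crossC oppr_eq0; case: (w == 0); case: (cross u w == 0).
rewrite (_ : #|F|.-1 * (#|F| + #|B|) = #|F|.-1 * #|F| + \sum_(z' in B) #|F|.-1)%N; last first.
  by rewrite sum_nat_const mulnDr [(#|B| * _)%N]mulnC.
rewrite (bigD1 z) //= [X in (_ <= _ + X)%N](bigD1 z) //= addnA leq_add //.
  rewrite -mulnSr -card_nonzero_cv2 -sum1_card [leqRHS](eq_bigl (fun w : 'cV[F]_2 => w != 0)).
    by apply: leq_sum => w _; apply: leq_b1.
  by move=> w; rewrite inE.
by apply: leq_sum => z' /andP[_ zz']; apply: off; rewrite subr_eq0 eq_sym.
Qed.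

(** The excess is nonnegative and constant on the q - 1 nonzero points of a line, and each line
    meets B in at most k points. So q - 1 times the sum over B is at most k times the sum over all
    nonzero w, where the terms q n^2 cancel. *)
Lemma sum_cross_excess (F : finFieldType) (B : {set 'cV[F]_2}) (k : nat) :
  0 \notin B -> (forall w : 'cV[F]_2, w != 0 -> (#|[set y in B | cross w y == 0%R]| <= k)%N) ->
  \sum_(y in B) cross_excess B y <= (k * #|F| ^ 2 * #|B|)%N%:Z.
Proof.
move=> B0 hk; set G := cross_excess B; set q := #|F|; set n := #|B|.
have q1 : (1 < q)%N by apply/card_gt1P; exists 0, 1; split; rewrite // eq_sym oner_neq0.
have r0 : 0 < q.-1%:Z by rewrite ltz_nat -ltnS prednK // ltnW.
rewrite -(ler_pM2l r0) mulr_sumr.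
have step1 y : y \in B -> q.-1%:Z * G y <= \sum_(w | (w != 0) && (cross y w == 0)) G w.
  move=> yB; have y0 : y != 0 by apply: contraNneq B0 => <-.
  rewrite (eq_bigr (fun=> G y)) => [|w /andP[w0 /eqP yw]]; last first.
    have [c wE] := cross_eq0_line y0 yw; rewrite wE; apply: cross_excessZ.
    by apply: contraNneq w0 => c0; rewrite wE c0 scale0r.
  rewrite sumr_const -mulr_natl natz ler_wpM2r ?cross_excess_ge0 // lez_nat.
  have -> : q.-1 = #|[set~ (0 : F)]| by rewrite cardsC1.
  rewrite -[X in (_ <= X)%N]cardsE; apply: (@card_leq_inj _ _ (fun s => s *: y)).
    by move=> s s' _ _ /eqP; rewrite -subr_eq0 -scalerBl scaler_eq0 (negbTE y0) orbF
      subr_eq0 => /eqP.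
  move=> s; rewrite !inE => s0; rewrite unfold_in /= scaler_eq0 negb_or s0 y0 /=.
  by rewrite crossC crossZ /cross [y 0 0 * _]mulrC subrr mulr0 oppr0.
apply: le_trans (ler_sum _ step1) _.
under eq_bigr do rewrite big_mkcondr /=.
rewrite exchange_big /=.
apply: (@le_trans _ _ (\sum_(w | w != 0) k%:Z * G w)).
  apply: ler_sum => w w0; rewrite -big_mkcondr sumr_const -mulr_natl natz.
  rewrite ler_wpM2r ?cross_excess_ge0 // lez_nat; apply: leq_trans (hk w w0).
  apply/subset_leq_card/subsetP => y; rewrite unfold_in /= !inE crossC oppr_eq0 => /andP[-> ->] //.
rewrite -mulr_sumr sumrB -mulr_sumr sumr_const -sumPosz -mulr_natl natz.
have -> : #|(fun w : 'cV[F]_2 => w != 0)| = (q.-1 * q.+1)%N.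
  by rewrite -card_nonzero_cv2; apply: eq_card => w; rewrite inE.
have := sum_cross_energy B; rewrite -/q -/n -lez_nat => hE.
have h2 := ler_wpM2l (isT : 0 <= q%:Z) hE.
apply: (@le_trans _ _ (k%:Z * (q%:Z * (n * (q.-1 * (q + n)))%N%:Z
   - (q.-1 * q.+1)%N%:Z * (n ^ 2)%N%:Z))).
  by rewrite ler_wpM2l // lerD2r.
rewrite -[q.+1]addn1 !PoszM !PoszD.
rewrite [leRHS](_ : _ = k%:Z * (q.-1%:Z * (q%:Z ^+ 2 * n%:Z))); last by ring.
rewrite ler_wpM2l // -subr_ge0 (_ : _ - _ = q.-1%:Z * n%:Z ^+ 2); last by ring.
by rewrite mulr_ge0 // exprn_ge0.
Qed.

(** Equidistribution gives the main term |B|^4. The deviation of the total from its mean is the sum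
    over y in B of the individual deviations, so Cauchy-Schwarz over y bounds the variance by |B|
    times the summed excess. *)
Lemma sum_sqr_cross_counts (F : finFieldType) (B : {set 'cV[F]_2}) (k : nat) :
  0 \notin B -> (forall w : 'cV[F]_2, w != 0 -> (#|[set y in B | cross w y == 0%R]| <= k)%N) ->
  (#|F| * (\sum_d (\sum_(y in B) cross_count B y d) ^ 2)
     <= #|B| ^ 4 + k * #|F| ^ 2 * #|B| ^ 2)%N.
Proof.
move=> B0 hk; have := sum_cross_excess B0 hk; set n := #|B|; set q := #|F| => hG.
pose f y d := (cross_count B y d)%:Z; pose nu d := \sum_(y in B) f y d.
have q0 : 0 < q%:Z by rewrite ltz_nat; apply/card_gt0P; exists 0.
have fn y : \sum_d f y d = n%:Z by rewrite /f -sumPosz sum_cross_count.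
have nun : \sum_d nu d = n%:Z ^+ 2.
  by rewrite /nu exchange_big /= (eq_bigr (fun=> n%:Z)) // sumr_const -mulr_natl natz expr2.
have h1 := @sum_centered_sqr F q%:Z nu (n%:Z ^+ 2) erefl nun.
have h2 : \sum_d (q%:Z * nu d - n%:Z ^+ 2) ^+ 2
    <= n%:Z * \sum_(y in B) \sum_d (q%:Z * f y d - n%:Z) ^+ 2.
  rewrite exchange_big /= mulr_sumr; apply: ler_sum => d _.
  have -> : q%:Z * nu d - n%:Z ^+ 2 = \sum_(y in B) (q%:Z * f y d - n%:Z).
    by rewrite sumrB -mulr_sumr sumr_const -mulr_natl natz expr2.
  by have := sqr_sum_leq_card B (fun y => q%:Z * f y d - n%:Z); rewrite natz.
have h3 y : \sum_d (q%:Z * f y d - n%:Z) ^+ 2 = q%:Z * cross_excess B y.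
  rewrite (@sum_centered_sqr F q%:Z (f y) n%:Z erefl (fn y)) /cross_excess /cross_energy.
  rewrite PoszM_sqr; congr (_ * (_ * _ - _)); rewrite sumPosz.
  by apply: eq_bigr => d _; rewrite PoszM_sqr.
rewrite h1 (eq_bigr _ (fun y _ => h3 y)) -mulr_sumr mulrCA ler_pM2l // in h2.
have {}h2 := le_trans h2 (ler_wpM2l (isT : 0 <= n%:Z) hG).
rewrite -lez_nat PoszM PoszD sumPosz.
have -> : \sum_d ((\sum_(y in B) cross_count B y d) ^ 2)%N%:Z = \sum_d nu d ^+ 2.
  by apply: eq_bigr => d _; rewrite PoszM_sqr sumPosz.
have -> : (n ^ 4)%N%:Z = n%:Z ^+ 2 ^+ 2 by rewrite (expnM n 2 2) !PoszM_sqr.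
rewrite -lerBlDl.
apply: le_trans h2 _.
by rewrite lez_nat; apply: eq_leq; ring.
Qed.

(* For linearly independent y, z, the pair (m y, m z) determines m and has the same cross
   product as (y, z); the dependent pairs are counted separately. *)
Lemma unimodular_second_moment (F : finFieldType) (B : {set 'cV[F]_2}) (k : nat) :
  0 \notin B -> (forall w : 'cV[F]_2, w != 0 -> (#|[set y in B | cross w y == 0%R]| <= k)%N) ->
  (#|F| * (\sum_(m in unimodular F) #|[set y in B | m *m y \in B]| ^ 2)
     <= #|B| ^ 4 + 2 * (k * #|F| ^ 2 * #|B| ^ 2))%N.
Proof.
move=> B0 hk; set q := #|F|; set n := #|B|.
pose W y z := #|[set m in unimodular F | (m *m y \in B) && (m *m z \in B)]|.
have -> : (\sum_(m in unimodular F) #|[set y in B | m *m y \in B]| ^ 2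
    = \sum_(y in B) \sum_(z in B) W y z)%N.
  under eq_bigr do rewrite card_set_sum -mulnn big_distrlr /=.
  rewrite exchange_big; apply: eq_bigr => y _ /=; rewrite exchange_big; apply: eq_bigr => z _ /=.
  by rewrite /W card_set_sum; apply: eq_bigr => m _; case: (_ \in B); case: (_ \in B).
have B00 y : y \in B -> y != 0 by move=> yB; apply: contraNneq B0 => <-.
pose nu d := (\sum_(y in B) cross_count B y d)%N.
have Wle y z : y \in B -> z \in B ->
    (W y z <= nu (cross y z) + (if cross y z == 0%R then n * q else 0))%N.
  move=> yB zB; case: ifPn => [_|yz].
    apply: leq_trans (leq_addl _ _); rewrite mulnC.
    apply: (@card_leq_fibers _ _ (fun m => m *m y)).
      by move=> m; rewrite inE => /and3P[].
    move=> v vB; apply: leq_trans (card_unimodular_map v (B00 y yB)).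
    by apply/subset_leq_card/subsetP => m; rewrite !inE => /andP[/andP[-> _] ->].
  rewrite addn0 /W; pose D := [set t in setX B B | cross t.1 t.2 == cross y z].
  have -> : nu (cross y z) = #|D|.
    rewrite /nu /cross_count /D card_set_sum.
    rewrite (eq_bigl (fun t : 'cV[F]_2 * 'cV[F]_2 => (t.1 \in B) && (t.2 \in B))).
      rewrite -(pair_big (mem B) (mem B) (fun u v => nat_of_bool (cross u v == cross y z))) /=.
      by apply: eq_bigr => u _; rewrite card_set_sum.
    by case=> u v; rewrite in_setX.
  apply: (@card_leq_inj _ _ (fun m => (m *m y, m *m z))).
    move=> m m' _ _ [ey ez].
    have [[c zE]|//] := agree_on_two_vectors (B00 y yB) ey ez.
    by move: yz; rewrite zE crossC crossZ /cross [y 0 0 * _]mulrC subrr mulr0 oppr0 eqxx.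
  by move=> m; rewrite !inE /= => /andP[/eqP dm /andP[-> ->]]; rewrite cross_mul dm mul1r eqxx.
apply: (@leq_trans (q * (\sum_(y in B) \sum_(z in B)
    (nu (cross y z) + (if cross y z == 0%R then n * q else 0))))).
  rewrite leq_mul2l; apply/orP; right; apply: leq_sum => y yB; apply: leq_sum => z zB.
  exact: Wle.
under eq_bigr do rewrite big_split /=.
rewrite big_split /= mulnDr mul2n -addnn addnA; apply: leq_add.
  have -> : (\sum_(y in B) \sum_(z in B) nu (cross y z) = \sum_d nu d ^ 2)%N.
    rewrite [RHS](eq_bigr (fun d => \sum_(y in B) \sum_(z in B) (cross y z == d) * nu d)%N).
      rewrite [RHS]exchange_big; apply: eq_bigr => y _ /=; rewrite [RHS]exchange_big.
      apply: eq_bigr => z _ /=; rewrite (bigD1 (cross y z)) //= eqxx mul1n big1 ?addn0 //.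
      by move=> d; rewrite eq_sym => /negbTE ->.
    move=> d _; rewrite -mulnn {1}/nu big_distrl /=; apply: eq_bigr => y _.
    by rewrite /cross_count card_set_sum big_distrl.
  exact: sum_sqr_cross_counts.
rewrite (_ : k * q ^ 2 * n ^ 2 = q * (n * (k * (n * q))))%N; last by ring.
rewrite leq_mul2l; apply/orP; right; rewrite -[leqRHS](sum_nat_const (mem B)).
apply: leq_sum => y yB; rewrite -big_mkcondr sum_nat_const leq_mul2r; apply/orP; right.
apply: leq_trans (hk y (B00 y yB)); apply/subset_leq_card/subsetP => z.
by rewrite unfold_in /= inE.
Qed.

(** * Incidences *)

Definition return_count (p : nat) (B : {set 'cV['F_p]_2}) (g : {'GL_2['F_p]}) : nat :=
  #|[set y in B | mat g *m y \in B]|.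

Definition orbit_count (p : nat) (S : {set {'GL_2['F_p]}}) (B : {set 'cV['F_p]_2})
  (x : 'cV['F_p]_2) : nat := #|[set a in S | mat a *m x \in B]|.

Lemma matKV (p : nat) (g : {'GL_2['F_p]}) : mat g *m mat g^-1%g = 1%:M.
Proof. by rewrite -matM mulgV mat1. Qed.

(** An incidence g y = x is recorded as (x, g^-1), with g^-1 in S by symmetry. The origin can be
    removed from B because y = 0 forces x = 0, and (0, 0) is excluded. *)
Lemma incidences_leq_orbit_count (p : nat) (A B : {set 'cV['F_p]_2})
    (S : {set {'GL_2['F_p]}}) :
  (0, 0) \notin finset.setX A B -> (S = S^-1)%g ->
  (incidences (finset.setX A B) S <= \sum_(x in A) orbit_count S (B :\ 0%R) x)%N.
Proof.
move=> AB0 SV; pose D := [set t : 'cV['F_p]_2 * {'GL_2['F_p]} |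
  (t.1 \in A) && ((t.2 \in S) && (mat t.2 *m t.1 \in B :\ 0))].
have -> : (\sum_(x in A) orbit_count S (B :\ 0%R) x = #|D|)%N.
  rewrite -sum1dep_card.
  rewrite -(pair_big_dep (mem A) (fun x a => (a \in S) && (mat a *m x \in B :\ 0))
    (fun _ _ => 1%N)) /=.
  by apply: eq_bigr => x _; rewrite sum1dep_card /orbit_count; apply: eq_card => a; rewrite !inE.
apply: (@card_leq_inj _ _ (fun t => (t.1.1, t.2^-1%g))).
  move=> [[x y] g] [[x' y'] g']; rewrite !inE /= => /andP[_ /eqP gy] /andP[_ /eqP gy'] e.
  have xx : x = x' := congr1 fst e; have gg : g = g' := invg_inj (congr1 snd e).
  congr ((_, _), _) => //; rewrite -gg -xx in gy'.
  have e2 : mat g *m y = mat g *m y' := etrans gy (esym gy').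
  by rewrite -[y]mul1mx -[y']mul1mx -(matVK g) -!mulmxA e2.
move=> [[x y] g]; rewrite !inE /= => /andP[/andP[/andP[xA yB] gS] /eqP gy].
have {}gy : mat g *m y = x := gy.
have gx : mat g^-1%g *m x = y by rewrite -gy mulmxA (matVK g) mul1mx.
rewrite xA gx yB andbT /= SV inE invgK gS /=.
apply: contraNneq AB0 => y1; have y0 : y = 0 := y1; rewrite in_setX /= -{2}y0 yB andbT.
by rewrite -(mulmx0 _ (mat g)) -y0 gy.
Qed.

(** Substituting x = c^-1 y turns the condition that a x and c x lie in B into one on y and the
    quotient a c^-1. *)
Lemma sum_orbit_count_sqr (p : nat) (B : {set 'cV['F_p]_2}) (S : {set {'GL_2['F_p]}}) :
  (\sum_x orbit_count S B x ^ 2 = \sum_g quot_count S g * return_count B g)%N.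
Proof.
under eq_bigr do rewrite /orbit_count card_set_sum -mulnn big_distrlr /=.
rewrite exchange_big /=; under eq_bigr do rewrite exchange_big /=.
transitivity (\sum_(a in S) \sum_(c in S) return_count B (a * c^-1)%g)%N.
  apply: eq_bigr => a _; apply: eq_bigr => c _.
  rewrite (reindex (mulmx (mat c^-1%g))); last first.
    by exists (mulmx (mat c)) => y _; rewrite mulmxA ?(matVK c) ?(matKV c) mul1mx.
  rewrite /return_count card_set_sum [RHS]big_mkcond; apply: eq_bigr => y _.
  by rewrite !mulmxA (matKV c) mul1mx matM; case: (y \in B); rewrite ?muln1 ?muln0.
rewrite exchange_big /=.
under [RHS]eq_bigr do rewrite /quot_count card_set_sum big_distrl /=.
rewrite [RHS]exchange_big; apply: eq_bigr => c _ /=.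
rewrite [RHS](reindex_inj (mulIg c^-1%g)) /= big_mkcond; apply: eq_bigr => a _.
by rewrite (mulgKV c a); case: (a \in S); rewrite ?mul1n ?mul0n.
Qed.

Lemma cross_line_count (p k : nat) (B : {set 'cV['F_p]_2}) (w : 'cV['F_p]_2) :
  at_most_on_lines B k -> w != 0 ->
  (#|[set y in B :\ 0%R | cross w y == 0%R]| <= k)%N.
Proof.
move=> hB w0; have := hB <[w]>%VS; rewrite dim_vline w0 => /(_ erefl); apply: leq_trans.
apply/subset_leq_card/subsetP => y; rewrite inE in_setD1 => /andP[/andP[_ yB] /eqP wy].
by rewrite inE yB /=; apply/vlineP; have [c yE] := cross_eq0_line w0 wy; exists c.
Qed.

Lemma return_second_moment (p k : nat) (B : {set 'cV['F_p]_2}) : prime p ->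
  at_most_on_lines B k ->
  (p * \sum_(g in SL2 p) return_count (B :\ 0%R) g ^ 2
     <= #|B| ^ 4 + 2 * (k * p ^ 2 * #|B| ^ 2))%N.
Proof.
move=> pp hB; set B' := B :\ 0%R.
have B'0 : 0 \notin B' by rewrite in_setD1 eqxx.
have := unimodular_second_moment B'0 (fun w => cross_line_count hB).
rewrite card_Fp // => h.
have BB : (#|B'| <= #|B|)%N by apply/subset_leq_card/subsetDl.
apply: (@leq_trans (#|B'| ^ 4 + 2 * (k * p ^ 2 * #|B'| ^ 2))%N); last first.
  by rewrite leq_add ?leq_exp2r // !leq_mul2l leq_exp2r // BB !orbT.
apply: leq_trans h; rewrite leq_mul2l; apply/orP; right.
rewrite -(big_imset (fun m : 'M['F_p]_2 => #|[set y in B' | m *m y \in B']| ^ 2)%N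
  (h := @mat p) (A := mem (SL2 p))) /=; last by move=> g g' _ _ /mat_inj.
rewrite big_mkcond [leqRHS]big_mkcond; apply: leq_sum => m _.
by case: ifP => // /imsetP[g gS ->]; rewrite inE det_mat ?eqxx.
Qed.

Lemma incidences_energy (p k : nat) (A B : {set 'cV['F_p]_2}) (S : {set {'GL_2['F_p]}}) :
  prime p -> (0, 0) \notin finset.setX A B -> S \subset SL2 p -> (S = S^-1)%g ->
  at_most_on_lines B k ->
  (p * incidences (finset.setX A B) S ^ 4
     <= #|A| ^ 2 * mul_energy S * (#|B| ^ 4 + 2 * (k * p ^ 2 * #|B| ^ 2)))%N.
Proof.
move=> pp AB0 SS SV hB; set B' := B :\ 0%R.
set s := (\sum_g quot_count S g * return_count B' g)%N.
have I2 : (incidences (finset.setX A B) S ^ 2 <= #|A| * s)%N.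
  apply: (@leq_trans ((\sum_(x in A) orbit_count S B' x) ^ 2)).
    by rewrite leq_exp2r // incidences_leq_orbit_count.
  apply: leq_trans (sum_sqr_leq_card _ _) _; rewrite leq_mul2l; apply/orP; right.
  by rewrite /s -sum_orbit_count_sqr [leqRHS](bigID (mem A)) leq_addr.
(* Quotients of elements of S stay in SL_2, where the second moment of the return counts is
   controlled. *)
have sE : s = (\sum_(g in SL2 p) quot_count S g * return_count B' g)%N.
  rewrite /s (bigID (mem (SL2 p))) /= [X in (_ + X)%N]big1 ?addn0 // => g gS.
  rewrite /quot_count (_ : [set b in S | _] = set0) ?cards0 ?mul0n //.
  apply/setP => b; rewrite !inE; apply/negP => /andP[bS gbS]; case/negP: gS.
  by rewrite -(groupMr _ (subsetP SS _ bS)) (subsetP SS).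
have s2 : (s ^ 2 <= mul_energy S * \sum_(g in SL2 p) return_count B' g ^ 2)%N.
  rewrite sE; apply: leq_trans (sum_leq_CauchySchwarz _ _ _) _.
  by rewrite leq_mul2r /mul_energy [leqRHS](bigID (mem (SL2 p))) leq_addr orbT.
have := return_second_moment pp hB; rewrite -/B'.
move: (\sum_(g in SL2 p) _)%N (mul_energy S) (#|B| ^ 4 + _)%N s2 => t e u s2 hu.
rewrite (expnM _ 2 2); apply: (@leq_trans (p * (#|A| * s) ^ 2)%N).
  by rewrite leq_mul2l leq_exp2r // I2 orbT.
rewrite expnMn; apply: (@leq_trans (p * (#|A| ^ 2 * (e * t)))%N).
  by rewrite !leq_mul2l s2 !orbT.
rewrite (_ : p * (_ * _) = #|A| ^ 2 * e * (p * t))%N; last by ring.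
by rewrite leq_mul2l hu orbT.
Qed.

(* Choice of exponents and conclusion *)
From mathcomp Require Import all_classical all_reals all_analysis.

Lemma powR_root_exp (R : realType) (x a : R) (n m : nat) :
  0 <= x -> a * n%:R = m%:R -> (x `^ a) ^+ n = x ^+ m.
Proof.
by move=> x0 anm; rewrite -powR_mulrn ?powR_ge0 // -powRrM anm powR_mulrn.
Qed.

(** [energy_structure] takes an integer K; rounding x^eta up at most doubles it, which is at most a
    factor x^eta. *)
Lemma nat_between_powR (R : realType) (x eta : R) :
  0 <= x -> 2 <= x `^ eta ->
  exists K : nat, [/\ (2 <= K)%N, x `^ eta <= K%:R & K%:R <= x `^ (2 * eta)].
Proof.
move=> x0 h2; exists (Num.truncn (x `^ eta)).+1.
have /andP[lo hi] := truncn_itv (powR_ge0 x eta).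
split; [| exact: ltW |].
  by rewrite -(ler_nat R) (le_trans h2) // ltW.
rewrite [2 * eta]mulrC powRrM powR_mulrn ?powR_ge0 // expr2.
rewrite -natr1; apply: (@le_trans _ _ (x `^ eta + x `^ eta)).
  by rewrite lerD // (le_trans _ h2) // ler1n.
by rewrite -mulr2n -mulr_natl ler_wpM2r ?powR_ge0.
Qed.

(** If the energy exceeded |S|^3 / K with K between p^eta and p^(2 eta), [energy_structure] would
    contradict non-concentration, the lower bound or the upper bound on |S|. *)
Lemma energy_saving (R : realType) (gamma : R) : 0 < gamma < 1 ->
  exists2 eta : R, 0 < eta & exists p0 : nat, forall p : nat, prime p -> (p0 <= p)%N ->
  forall S : {set {'GL_2['F_p]}}, S \subset SL2 p ->
    p%:R `^ gamma < #|S|%:R :> R -> #|S|%:R < p%:R `^ (3 - 2 * gamma) :> R ->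
    (forall (H : {group {'GL_2['F_p]}}) (g : {'GL_2['F_p]}),
        H \proper SL2 p -> g \in SL2 p ->
        #|S :&: (g *: H)%g|%:R < p%:R `^ (- gamma / 2) * #|S|%:R :> R) ->
    p%:R `^ eta * (mul_energy S)%:R <= #|S|%:R ^+ 3 :> R.
Proof.
move=> /andP[g0 g1]; have [N hN] := energy_structure.
have N0 : (0 : R) < 4 * N.+1%:R by rewrite mulr_gt0.
(* Chosen so that K^N <= p^(2 eta N) <= p^(gamma/2). *)
exists (gamma / (4 * N.+1%:R)); first by rewrite divr_gt0.
set eta := gamma / _; have eta0 : 0 < eta by rewrite divr_gt0.
(* Ensures p > 2 and p^eta >= 2. *)
exists (maxn 3 (Num.truncn ((2 : R) `^ eta^-1)).+1) => p pp.
rewrite geq_max => /andP[p3 hp] S SS Slo Shi Scos.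
have p1 : (1 : R) < p%:R by rewrite ltr1n (leq_trans _ p3).
have p0 : (0 : R) < p%:R by apply: lt_trans p1.
have mono a b : a <= b -> (p%:R `^ a : R) <= p%:R `^ b by move=> ab; rewrite ler_powR // ltW.
have h2 : 2 <= (p%:R : R) `^ eta.
  have -> : (2 : R) = (2 `^ eta^-1) `^ eta by rewrite -powRrM mulVf ?gt_eqF // powRr1.
  apply: ge0_ler_powR; rewrite ?nnegrE ?powR_ge0 ?(ltW eta0) ?(ltW p0) //.
  have /andP[_ /ltW h] := truncn_itv (powR_ge0 (2 : R) eta^-1).
  by apply: le_trans h _; rewrite ler_nat.
have [K [K2 Klo Khi]] := nat_between_powR (ltW p0) h2.
have KN : (K ^ N)%N%:R <= p%:R `^ (gamma / 2) :> R.
  rewrite natrX; apply: (@le_trans _ _ ((p%:R `^ (2 * eta)) ^+ N)).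
    by rewrite lerXn2r ?nnegrE ?powR_ge0.
  rewrite -powR_mulrn ?powR_ge0 // -powRrM; apply: mono.
  have -> : gamma / 2 = 2 * eta * N.+1%:R.
    have : (N.+1%:R : R) != 0 by rewrite pnatr_eq0.
    by rewrite /eta; move: (N.+1%:R : R) => n n0; field.
  by rewrite ler_wpM2l ?ler_nat // mulr_ge0 // ltW.
have S0 : (0 : R) < #|S|%:R by apply: le_lt_trans Slo; apply: powR_ge0.
have [hE|] := leqP (K * mul_energy S) (#|S| ^ 3).
  apply: (@le_trans _ _ ((K * mul_energy S)%N%:R)); last by rewrite -natrX ler_nat.
  by rewrite natrM ler_wpM2r.
move=> /ltnW hE; exfalso.
have SN : (0 < #|S|)%N by rewrite -(ltr_nat R).
case: (hN p K S pp p3 K2 SN SS hE) => [[H [g [HS gS hH]]]|h|h].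
- have := Scos H g HS gS; rewrite ltNge => /negP; apply.
  rewrite -(ler_nat R) natrM in hH.
  rewrite mulNr powRN mulrC ler_pdivrMr ?powR_gt0 //; apply: le_trans hH _.
  by rewrite mulrC ler_wpM2l.
- move: Slo; rewrite ltNge => /negP; apply; rewrite -(ler_nat R) in h.
  apply: le_trans h (le_trans KN (mono _ _ _)); rewrite ler_pdivrMr // ler_peMr ?ltW //.
  by rewrite ltr1n.
have : (p%:R ^+ 6 : R) < p%:R ^+ 6; last by rewrite ltxx.
rewrite -(ler_nat R) natrM !natrX in h; apply: le_lt_trans h _.
apply: (@lt_le_trans _ _ (p%:R `^ (gamma / 2) * (p%:R `^ (3 - 2 * gamma)) ^+ 2)).
  apply: (@le_lt_trans _ _ (p%:R `^ (gamma / 2) * #|S|%:R ^+ 2)).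
    by rewrite ler_wpM2r ?exprn_ge0 // -natrX.
  by rewrite ltr_pM2l ?powR_gt0 // ltrXn2r ?nnegrE ?powR_ge0 // ltW.
(* The exponents add up to gamma/2 + 2 (3 - 2 gamma) = 6 - 7 gamma / 2 < 6. *)
rewrite -powR_mulrn ?powR_ge0 // -powRrM -powRD; last by apply/implyP => _; rewrite gt_eqF.
rewrite -(powR_mulrn 6 (ltW p0)); apply: mono.
by have := ltW g0; lra.
Qed.

Theorem theorem2p10 (R : realType) (gamma : R) (hgamma : 0 < gamma < 1) :
  exists2 eps : R, 0 < eps &
  exists2 C : R, 0 < C &
  exists p0 : nat, forall p : nat, prime p -> (p0 <= p)%N ->
  forall (A B : {set 'cV['F_p]_2}) (S : {set {'GL_2['F_p]}}) (k : nat),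
    (0, 0) \notin finset.setX A B ->
    S \subset SL2 p ->
    (S = S^-1)%g ->
    p%:R `^ gamma < #|S|%:R :> R ->
    #|S|%:R < p%:R `^ (3 - 2 * gamma) :> R ->
    (forall (H : {group {'GL_2['F_p]}}) (g : {'GL_2['F_p]}),
        H \proper SL2 p -> g \in SL2 p ->
        #|S :&: (g *: H)%g|%:R < p%:R `^ (- gamma / 2) * #|S|%:R :> R) ->
    at_most_on_lines B k ->
    (#|B|%:R < k%:R `^ (1 / 2) * p%:R :> R ->
       (incidences (finset.setX A B) S)%:R <=
         C * log2 p%:R *
         (k%:R `^ (1 / 2) * #|A|%:R `^ (1 / 2) * #|S|%:R
          + k%:R `^ (1 / 4) * p%:R `^ ((1 - eps) / 4) * #|A|%:R `^ (1 / 2)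
            * #|B|%:R `^ (1 / 2) * #|S|%:R `^ (3 / 4)) :> R)
    /\
    (k%:R `^ (1 / 2) * p%:R <= #|B|%:R :> R ->
       (incidences (finset.setX A B) S)%:R <=
         C * log2 p%:R *
         (#|A|%:R `^ (1 / 2) * #|B|%:R * #|S|%:R `^ (3 / 4)
          / p%:R `^ ((1 + eps) / 4)) :> R).
Proof.
have [eta eta0 [p0 hE]] := energy_saving hgamma.
(* The saving p^eta in the energy survives the fourth root as p^(eta/4). The constant 3 comes from
   |B|^4 + 2 k p^2 |B|^2 <= 3 z with z the larger of |B|^4 and k p^2 |B|^2. *)
exists eta => //; exists 3 => //; exists p0 => p pp pp0 A B S k AB0 SS SV Slo Shi Scos hB.
have {hE} := hE p pp pp0 S SS Slo Shi Scos.
have := incidences_energy pp AB0 SS SV hB; rewrite -(ler_nat R).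
set I := incidences _ _; move: (mul_energy S) => E.
rewrite !(natrM, natrD, natrX).
have pR : (2 : R) <= p%:R by rewrite ler_nat prime_gt1.
have log1 : 1 <= log2 (p%:R : R).
  by rewrite /log2 ler_pdivlMr ?mul1r ?ln_gt0 ?ltr1n // ler_ln ?posrE // (lt_le_trans _ pR).
move: (log2 _) log1 => l l1.
have : (0 : R) <= k%:R by []. have : (0 : R) <= E%:R by [].
have : (0 : R) <= #|S|%:R by []. have : (0 : R) <= #|A|%:R by [].
have : (0 : R) <= #|B|%:R by []. have : (0 : R) <= I%:R by [].
have : (0 : R) < p%:R by apply: lt_le_trans pR.
move: (p%:R : R) (I%:R : R) (#|B|%:R : R) (#|A|%:R : R) (#|S|%:R : R) (E%:R : R) (k%:R : R).
move=> q i b a s e c q0 i0 b0 a0 s0 e0 c0 hI hE.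
have fin X Y : 0 <= X -> 0 <= Y -> i ^+ 4 <= 3 * X ^+ 4 -> i <= 3 * l * (Y + X).
  move=> X0 Y0 h; apply: (@le_trans _ _ (3 * X)).
    rewrite -(@ler_pXn2r _ 4) ?nnegrE ?mulr_ge0 //; apply: le_trans h _.
    by rewrite exprMn ler_wpM2r ?exprn_ge0 // -natrX ler_nat.
  rewrite -mulrA ler_wpM2l //; apply: (@le_trans _ _ (Y + X)); first by rewrite lerDr.
  by rewrite ler_peMl // addr_ge0.
have qe0 : 0 < q `^ eta by apply: powR_gt0.
have qn : q != 0 by rewrite gt_eqF.
have q0' : 0 <= q by apply: ltW.
have cs : (c `^ (1 / 2)) ^+ 2 = c ^+ 1 by apply: powR_root_exp => //; lra.
have a4 : (a `^ (1 / 2)) ^+ 4 = a ^+ 2 by apply: powR_root_exp => //; lra.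
have b4 : (b `^ (1 / 2)) ^+ 4 = b ^+ 2 by apply: powR_root_exp => //; lra.
have s4 : (s `^ (3 / 4)) ^+ 4 = s ^+ 3 by apply: powR_root_exp => //; lra.
have c4 : (c `^ (1 / 4)) ^+ 4 = c ^+ 1 by apply: powR_root_exp => //; lra.
have q4 : (q `^ ((1 - eta) / 4)) ^+ 4 = q / q `^ eta.
  rewrite -powR_mulrn ?powR_ge0 // -powRrM (_ : _ * 4 = 1 - eta); last by lra.
  by rewrite powRD ?qn ?implybT // powRr1 ?ltW // powRN.
have q4' : (q `^ ((1 + eta) / 4)) ^+ 4 = q * q `^ eta.
  rewrite -powR_mulrn ?powR_ge0 // -powRrM (_ : _ * 4 = 1 + eta); last by lra.
  by rewrite powRD ?qn ?implybT // powRr1 ?ltW.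
(* The two cases of the theorem decide which of b^4 and c q^2 b^2 dominates and is taken as [z]. *)
have main z : b ^+ 4 + 2 * (c * q ^+ 2 * b ^+ 2) <= 3 * z ->
    i ^+ 4 <= 3 * (a ^+ 2 * (s ^+ 3 / q `^ eta) * z / q).
  move=> hz; rewrite -(ler_pM2l q0); apply: le_trans hI _.
  have -> : q * (3 * (a ^+ 2 * (s ^+ 3 / q `^ eta) * z / q))
      = a ^+ 2 * (s ^+ 3 / q `^ eta) * (3 * z).
    by field; rewrite !gt_eqF.
  apply: ler_pM => //; first by rewrite mulr_ge0 ?exprn_ge0.
    by rewrite addr_ge0 ?mulr_ge0 ?exprn_ge0.
  by rewrite ler_wpM2l ?exprn_ge0 // ler_pdivlMr // mulrC.
have cq2 : (c `^ (1 / 2) * q) ^+ 2 = c * q ^+ 2 by rewrite exprMn cs expr1.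
split=> hb.
  apply: fin; rewrite ?mulr_ge0 ?powR_ge0 //.
  have {}hb : b ^+ 2 <= c * q ^+ 2.
    by rewrite -cq2 lerXn2r ?nnegrE ?mulr_ge0 ?powR_ge0 // ltW.
  apply: le_trans (main (c * q ^+ 2 * b ^+ 2) _) _.
    have := ler_wpM2r (exprn_ge0 2 b0) hb; rewrite -exprD; lra.
  rewrite !exprMn a4 b4 s4 c4 q4 expr1 le_eqVlt; apply/orP; left; apply/eqP.
  by field; rewrite !gt_eqF.
rewrite -[X in _ <= _ * X]add0r; apply: fin => //.
  by rewrite mulr_ge0 ?invr_ge0 ?mulr_ge0 ?powR_ge0.
have {}hb : c * q ^+ 2 <= b ^+ 2.
  by rewrite -cq2 lerXn2r ?nnegrE ?mulr_ge0 ?powR_ge0.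
apply: le_trans (main (b ^+ 4) _) _.
  have := ler_wpM2r (exprn_ge0 2 b0) hb; rewrite -exprD; lra.
rewrite !exprMn exprVn a4 s4 q4' le_eqVlt; apply/orP; left; apply/eqP.
by field; rewrite !gt_eqF.
Qed.
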